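(* Let $F:\mathbb{R}^d\to\mathbb{R}^d$ be monotone, $L$-Lipschitz and $\mu$-sharp ($\mu>0$), accessed through a stochastic oracle $\widehat F$ with parameters $\sigma$ and $L$ as described in the context, and let $\mathbf{u}^*$ satisfy $F(\mathbf{u}^* )=\mathbf{0}$. Given $\mathbf{u}_0\in\mathbb{R}^d$, a precision parameter $\epsilon>0$, and $0<\eta_0\le\frac1{3\sqrt3L}$, Algorithm 3 (described in the context) outputs a point $\mathbf{u}_N$ with $\mathbb{E}[\|\mathbf{u}_N-\mathbf{u}^*\|^2]\le\epsilon^2$ as well as $\mathbb{E}[\|F(\mathbf{u}_N)\|^2]\le L^2\epsilon^2$ after a total of $\mathcal{O}\big(\frac L\mu\log\frac{\|\mathbf{u}_0-\mathbf{u}^*\|}{\epsilon}\big)$ (inner) iterations, with at most $$\mathcal{O}\Big(\frac{\sigma^2(\mu+L)\log(\|\mathbf{u}_0-\mathbf{u}^*\|/\epsilon)+L^3\|\mathbf{u}_0-\mathbf{u}^*\|^2}{\mu^3\epsilon^2}\Big)$$ queries to $\widehat F$ in expectation.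
   Context: $\|\cdot\|$ is induced by an inner product on $\mathbb{R}^d$. $F$ is monotone if $\langle F(\mathbf{u})-F(\mathbf{v}),\mathbf{u}-\mathbf{v}\rangle\ge0$ for all $\mathbf{u},\mathbf{v}$. $F$ is $\mu$-sharp if $\langle F(\mathbf{u})-F(\mathbf{u}^* ),\mathbf{u}-\mathbf{u}^*\rangle\ge\mu\|\mathbf{u}-\mathbf{u}^*\|^2$ for all $\mathbf{u}\in\mathbb{R}^d$. A solution $\mathbf{u}^*$ is assumed to exist. Oracle. $P_z$ is a probability distribution; for $z\sim P_z$ and all $\mathbf{x},\mathbf{u},\mathbf{v}\in\mathbb{R}^d$: $\mathbb{E}_z[\widehat F(\mathbf{x},z)]=F(\mathbf{x})$; $\mathbb{E}_z[\|\widehat F(\mathbf{x},z)-F(\mathbf{x})\|^2]\le\sigma^2$; $\mathbb{E}_z[\|\widehat F(\mathbf{u},z)-\widehat F(\mathbf{v},z)\|^2]\le L^2\|\mathbf{u}-\mathbf{v}\|^2$. The oracle can be queried at several points with the same $z$. Each evaluation $\widehat F(\mathbf{x},z)$ counts as one query. Constants: $M=9L^2$, $\underline\eta=\frac{\eta_0(1-2M\eta_0^2)}{1-M\eta_0^2}$. Algorithm 2 (subroutine) with initial point $\mathbf{u}_0$, accuracy $\epsilon$ and a number of iterations $K$: set $\mathbf{v}_{-1}=\mathbf{u}_0$, $S_1^{(-1)}=\lceil8\sigma^2/\epsilon^2\rceil$, $\widetilde F(\mathbf{v}_{-1})=\frac1{S_1^{(-1)}}\sum_{i=1}^{S_1^{(-1)}}\widehat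 F(\mathbf{v}_{-1},z_i^{(-1)})$. For $k=1,\dots,K$: (1) $\mathbf{v}_{k-1}=\frac1{k+1}\mathbf{u}_0+\frac{k}{k+1}\mathbf{u}_{k-1}-\eta_{k-1}\widetilde F(\mathbf{v}_{k-2})$; (2) $p_{k-1}=\min(\frac2k,1)$, $S_1^{(k-1)}=\lceil\frac{8\sigma^2}{p_{k-1}\epsilon^2}\rceil$, $S_2^{(k-1)}=\lceil\frac{8L^2\|\mathbf{v}_{k-1}-\mathbf{v}_{k-2}\|^2}{p_{k-1}^2\epsilon^2}\rceil$; (3) with probability $p_{k-1}$ set $\widetilde F(\mathbf{v}_{k-1})=\frac1{S_1^{(k-1)}}\sum_{i=1}^{S_1^{(k-1)}}\widehat F(\mathbf{v}_{k-1},z_i^{(k-1)})$, and with probability $1-p_{k-1}$ set $\widetilde F(\mathbf{v}_{k-1})=\widetilde F(\mathbf{v}_{k-2})+\frac1{S_2^{(k-1)}}\sum_{i=1}^{S_2^{(k-1)}}\big(\widehat F(\mathbf{v}_{k-1},z_i^{(k-1)})-\widehat F(\mathbf{v}_{k-2},z_i^{(k-1)})\big)$ (the correction term is $\mathbf{0}$ if $\mathbf{v}_{k-1}=\mathbf{v}_{k-2}$); (4) $\mathbf{u}_k=\frac1{k+1}\mathbf{u}_0+\frac{k}{k+1}\mathbf{u}_{k-1}-\eta_{k-1}\widetilde F(\mathbf{v}_{k-1})$; (5) $\eta_k=\frac{\big(1-\frac1{(k+1)^2}-M\eta_{k-1}^2\big)(k+1)^2}{(1-M\eta_{k-1}^2)\,k(k+2)}\,\eta_{k-1}$.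 Return $\mathbf{u}_K$. All $z_i^{(j)}\sim P_z$ are i.i.d.; the samples and coin flip used at each step are independent of each other and of the past. Algorithm 3 (Restarted Extrapolated Stochastic Halpern-Sharp). Let $N=\Big\lceil\log_2\Big(\frac{\sqrt6\|\mathbf{u}_0-\mathbf{u}^*\|}{2\epsilon}\Big)\Big\rceil$. For $k=1,\dots,N$: call Algorithm 2 afresh (with independent randomness, with the same $\eta_0$) with initial point $\mathbf{u}_{k-1}$, accuracy $\epsilon_k=\frac{\mu\epsilon\sqrt{M\underline\eta^2}}{2\sqrt{5(1+M\underline\eta\eta_0)}}$, and number of iterations $K=\Big\lceil\frac{4\sqrt{L^2\eta_0\underline\eta+1}}{\mu\underline\eta}\Big\rceil$; let $\mathbf{u}_k$ be its output. Return $\mathbf{u}_N$. The total number of inner iterations is $NK$. $\mathcal{O}(\cdot)$ is in the regime of small $\epsilon$ with the other parameters fixed (and $\mathbf{u}_0\ne\mathbf{u}^*$); the hidden constants are absolute for $\eta_0$ of order $1/L$, i.e. they may depend on the product $L\eta_0$ only. *)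

(* Defs.v *)
From HB Require Import structures.
From mathcomp Require Import all_boot all_order all_algebra.
From mathcomp Require Import all_classical all_reals all_analysis.

Set Implicit Arguments.
Unset Strict Implicit.
Unset Printing Implicit Defensive.

Import Order.TTheory GRing.Theory Num.Theory.
Import numFieldNormedType.Exports.

Local Open Scope classical_set_scope.
Local Open Scope ring_scope.

(* R^d is 'rV[R]_d with an arbitrary inner product;
   [dnorm dot] is the norm it induces (not the canonical sup norm `|u|). *)

Section Operators.
Context {R : realType} {d : nat} (dot : {dot 'rV[R]_d for idfun}).

Definition dnorm (u : 'rV[R]_d) : R := Num.sqrt (dot u u).

Definition monotone_operator (F : 'rV[R]_d -> 'rV[R]_d) : Prop :=
  forall u v, 0 <= dot (F u - F v) (u - v).

Definition lipschitz_operator (L : R) (F : 'rV[R]_d -> 'rV[R]_d) : Prop :=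
  forall u v, dnorm (F u - F v) <= L * dnorm (u - v).

Definition sharp_operator (mu : R) (F : 'rV[R]_d -> 'rV[R]_d)
    (ustar : 'rV[R]_d) : Prop :=
  forall u, mu * dnorm (u - ustar) ^+ 2 <= dot (F u - F ustar) (u - ustar).

(* Joint measurability is what makes the expectations along the random iterates
   meaningful; R^d carries the Borel sigma-algebra, i.e. the product one, here
   through the measurable type of d-tuples. *)
Record stochastic_oracle (dZ : measure_display) (Z : measurableType dZ)
    (Pz : probability Z R) (F : 'rV[R]_d -> 'rV[R]_d)
    (Fhat : 'rV[R]_d -> Z -> 'rV[R]_d) (sigma L : R) : Prop := {
  oracle_measurable : forall j : 'I_d,
    measurable_fun [set: d.-tuple R * Z]
      (fun xz => Fhat (\row_i tnth xz.1 i) xz.2 0 j) ;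
  oracle_unbiased : forall x (j : 'I_d),
    ('E_Pz[fun z => (Fhat x z 0 j)%R] = (F x 0 j)%:E)%E ;
  oracle_variance : forall x,
    ('E_Pz[fun z => (dnorm (Fhat x z - F x) ^+ 2)%R] <= (sigma ^+ 2)%:E)%E ;
  oracle_lipschitz : forall u v,
    ('E_Pz[fun z => (dnorm (Fhat u z - Fhat v z) ^+ 2)%R]
       <= (L ^+ 2 * dnorm (u - v) ^+ 2)%:E)%E }.

End Operators.

Section Scalars.
Context {R : realType}.

(* The ceiling, as a natural number; it is 0 on nonpositive reals. *)
Definition nceil (x : R) : nat := `|Num.ceil (Num.max 0 x)%R|%N.

(* [batch_size x] is the ceiling of x when 0 < x. For x = 0, which only arises
   from sigma = 0, one sample is drawn, as an empirical mean needs one. *)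
Definition batch_size (x : R) : nat := maxn 1 (nceil x).

Definition log2 (x : R) : R := ln x / ln 2.

Definition coefM (L : R) : R := 9 * L ^+ 2.

Fixpoint stepsize (M eta0 : R) (k : nat) : R :=
  if k is j.+1 then
    let eta := stepsize M eta0 j in
    ((1 - (k.+1%:R ^+ 2)^-1 - M * eta ^+ 2) * k.+1%:R ^+ 2)
      / ((1 - M * eta ^+ 2) * k%:R * k.+2%:R) * eta
  else eta0.

Definition eta_low (M eta0 : R) : R :=
  eta0 * (1 - 2 * M * eta0 ^+ 2) / (1 - M * eta0 ^+ 2).

(* p_{k-1}, used at iteration k >= 1 *)
Definition coin_prob (k : nat) : R := Num.min (2 / k%:R) 1.

End Scalars.

(* The algorithms run on a fixed realization of the randomness. Within one call
   of [halpern], [z 0 i] are the samples of the initial estimate at v_{-1} and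
   [z k i], [c k] are the samples and the coin of iteration k >= 1 ([c k = true]
   meaning a fresh estimate), so that [z k] is z^{(k-1)} and samples are numbered
   from 0. *)
Section Algorithms.
Context {R : realType} {d : nat} (dot : {dot 'rV[R]_d for idfun}).
Context {dZ : measure_display} {Z : measurableType dZ}.
Variables (Fhat : 'rV[R]_d -> Z -> 'rV[R]_d) (sigma L mu eta0 : R).

(* After iteration k: u_k, v_{k-1}, the estimate of F(v_{k-1}), and the number
   of evaluations of [Fhat] made so far in the call. *)
Record halpern_state := HalpernState {
  st_u : 'rV[R]_d ;
  st_v : 'rV[R]_d ;
  st_est : 'rV[R]_d ;
  st_queries : nat }.

Definition sample_mean (S : nat) (G : Z -> 'rV[R]_d) (z : nat -> Z) :
    'rV[R]_d :=
  S%:R^-1 *: \sum_(i < S) G (z i).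

Definition halpern_init (u0 : 'rV[R]_d) (eps : R) (z : nat -> Z) :
    halpern_state :=
  let S1 := batch_size (8 * sigma ^+ 2 / eps ^+ 2) in
  HalpernState u0 u0 (sample_mean S1 (Fhat u0) z) S1.

Definition halpern_step (u0 : 'rV[R]_d) (eps : R) (k : nat) (z : nat -> Z)
    (c : bool) (s : halpern_state) : halpern_state :=
  let eta := stepsize (coefM L) eta0 k.-1 in
  let p := coin_prob k in
  let anchor := k.+1%:R^-1 *: u0 + (k%:R / k.+1%:R) *: st_u s in
  let v := anchor - eta *: st_est s in
  let S1 := batch_size (8 * sigma ^+ 2 / (p * eps ^+ 2)) in
  let S2 := nceil (8 * L ^+ 2 * dnorm dot (v - st_v s) ^+ 2
                     / (p ^+ 2 * eps ^+ 2)) in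
  let est :=
    if c then sample_mean S1 (Fhat v) z
    else st_est s + sample_mean S2 (fun y => Fhat v y - Fhat (st_v s) y) z in
  HalpernState (anchor - eta *: est) v est
    (st_queries s + if c then S1 else 2 * S2).

Fixpoint halpern (u0 : 'rV[R]_d) (eps : R) (z : nat -> nat -> Z)
    (c : nat -> bool) (k : nat) : halpern_state :=
  if k is j.+1 then halpern_step u0 eps k (z k) (c k) (halpern u0 eps z c j)
  else halpern_init u0 eps (z 0%N).

Definition restart_calls (u0 ustar : 'rV[R]_d) (eps : R) : nat :=
  nceil (log2 (Num.sqrt 6 * dnorm dot (u0 - ustar) / (2 * eps))).

Definition restart_accuracy (eps : R) : R :=
  let M := coefM L in let el := eta_low M eta0 in
  (mu * eps * Num.sqrt (M * el ^+ 2)) / (2 * Num.sqrt (5 * (1 + M * el * eta0))).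

Definition restart_inner : nat :=
  let el := eta_low (coefM L) eta0 in
  nceil (4 * Num.sqrt (L ^+ 2 * eta0 * el + 1) / (mu * el)).

(* The output u_n of the n-th call, run on [z n] and [c n] for n >= 1, and the
   total number of queries made by the first n calls. *)
Fixpoint restarted (u0 : 'rV[R]_d) (eps : R) (z : nat -> nat -> nat -> Z)
    (c : nat -> nat -> bool) (n : nat) : 'rV[R]_d * nat :=
  if n is m.+1 then
    let: (u, q) := restarted u0 eps z c m in
    let s := halpern u (restart_accuracy eps) (z n) (c n) restart_inner in
    (st_u s, (q + st_queries s)%N)
  else (u0, 0%N).

Definition restarted_output (u0 ustar : 'rV[R]_d) (eps : R) z c : 'rV[R]_d :=
  (restarted u0 eps z c (restart_calls u0 ustar eps)).1.

Definition restarted_queries (u0 ustar : 'rV[R]_d) (eps : R) z c : nat :=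
  (restarted u0 eps z c (restart_calls u0 ustar eps)).2.

End Algorithms.

Section Randomness.
Context {R : realType} {dO : measure_display} {Omega : measurableType dO}.
Variable P : probability Omega R.

Definition mutually_independent (I : eqType) (G : I -> set (set Omega)) : Prop :=
  forall (s : seq I) (E : I -> set Omega), uniq s ->
    (forall i, i \in s -> G i (E i)) ->
    P (\bigcap_(i in [set` s]) E i) = (\prod_(i <- s) P (E i))%E.

Context {dZ : measure_display} {Z : measurableType dZ}.

Definition randomness_sigma
    (z : nat -> nat -> nat -> {RV P >-> Z}) (c : nat -> nat -> {RV P >-> bool})
    (i : (nat * nat * nat) + (nat * nat)) : set (set Omega) :=
  match i with
  | inl (n, k, j) => preimage_set_system setT (z n k j) measurable
  | inr (n, k) => preimage_set_system setT (c n k) measurable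
  end.

Record algorithm_randomness (Pz : probability Z R)
    (z : nat -> nat -> nat -> {RV P >-> Z})
    (c : nat -> nat -> {RV P >-> bool}) : Prop := {
  sample_law : forall n k i A, measurable A -> distribution P (z n k i) A = Pz A ;
  coin_law : forall n k, (1 <= k)%N ->
    P [set w | c n k w] = (coin_prob k)%:E ;
  samples_coins_independent : mutually_independent (randomness_sigma z c) }.

End Randomness.

(* Main.v *)
Require Import Defs.
From HB Require Import structures.
From mathcomp Require Import all_boot all_order all_algebra.
From mathcomp Require Import all_classical all_reals all_analysis.
From mathcomp Require Import measurable_realfun.
From mathcomp Require Import ring lra zify.

Set Implicit Arguments.
Unset Strict Implicit.
Unset Printing Implicit Defensive.

Import Order.TTheory GRing.Theory Num.Theory.
Import numFieldNormedType.Exports.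

Local Open Scope classical_set_scope.
Local Open Scope ring_scope.

(** A call approximates the operator at the extrapolated points by an estimate
    [G k], and the proof separates what holds for arbitrary estimates from the mean
    of their errors.

    The errors.  A fresh batch has an error of mean square at most
    [p eps ^ 2 / 8]; a correction adds at most [p ^ 2 eps ^ 2 / 8] to the previous
    error, since its samples are independent of the past and the oracle is Lipschitz
    in mean square.  With [p = 2 / k] the resulting recursion keeps the mean square
    of the [k]-th error below [eps ^ 2 / k] ([estimation_error_bound]).  Independence
    is used in one form only: a draw that is independent of what is known can be
    integrated out first, what is known being held fixed ([ge0_integral_sample],
    [ge0_integral_coin]).

    The trajectory.  Monotonicity and the Lipschitz condition give a potential of
    the form [A k (|F (u k)|^2 + |F (u k) - G k|^2) + (k + 1) <F (u k), u k - u0>],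
    with [A k] of order [eta k k ^ 2], that increases only by multiples of the
    squared errors ([potential_step]); the recursion for the step sizes is the one
    that makes the remaining quadratic form a perfect square.  Monotonicity with
    respect to the solution then bounds the residual [|F (u k)|^2] by
    [|u0 - ustar|^2 / k ^ 2] plus a weighted sum of squared errors
    ([halpern_residual]), which has a mean of order [eps ^ 2] ([call_residual]).

    Convergence.  Sharpness bounds the distance to the solution by the residual.
    With the chosen length and accuracy a call divides the mean squared distance by
    4, up to [eps ^ 2 / 4] ([restart_contraction]), so logarithmically many calls
    suffice ([restart_final]).

    Queries.  A fresh batch has a size inversely proportional to its probability
    and costs of order [sigma ^ 2 / eps ^ 2] in mean, for the accuracy [eps] of the
    call.  A correction batch at iteration [k] costs of order
    [k ^ 2 |v k - v (k - 1)|^2 L ^ 2 / eps ^ 2].  The displacement from the anchor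
    is a running average of the vectors [(k + 1) eta G k], so the potential also
    controls the lengths of the steps: this cost is of order
    [L ^ 2 |u0 - ustar|^2 / eps ^ 2] plus the square of the length of the call
    ([call_queries]).  Over the calls the squared distances decay geometrically, so
    the initial one is paid for once, without a logarithm ([restart_queries]). *)

(** * Inner products *)

Section InnerProduct.
Context {R : realType} {d : nat} (dot : {dot 'rV[R]_d for idfun}).
Implicit Types (u v w : 'rV[R]_d) (a : R).

Lemma dotC u v : dot u v = dot v u.
Proof. by rewrite (hermC dot) expr0 mul1r. Qed.

Lemma dotDl u v w : dot (u + v) w = dot u w + dot v w.
Proof. exact: linearDl. Qed.

Lemma dotDr u v w : dot u (v + w) = dot u v + dot u w.
Proof. exact: linearDr. Qed.

Lemma dotNl u v : dot (- u) v = - dot u v.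
Proof. exact: linearNl. Qed.

Lemma dotNr u v : dot u (- v) = - dot u v.
Proof. exact: linearNr. Qed.

Lemma dotZl a u v : dot (a *: u) v = a * dot u v.
Proof. by rewrite linearZl_LR. Qed.

Lemma dotZr a u v : dot u (a *: v) = a * dot u v.
Proof. by rewrite dotC dotZl dotC. Qed.

Lemma dot0l v : dot 0 v = 0.
Proof. exact: linear0l. Qed.

Lemma dot_suml I (r : seq I) (E : I -> 'rV[R]_d) v :
  dot (\sum_(i <- r) E i) v = \sum_(i <- r) dot (E i) v.
Proof. by rewrite linear_sumlz. Qed.

Definition dotE := (dotDl, dotDr, dotNl, dotNr, dotZl, dotZr).

Lemma dot_gt0 u : u != 0 -> 0 < dot u u.
Proof. exact: neq0_dnorm_gt0. Qed.

Lemma dot_ge0 u : 0 <= dot u u.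
Proof. by have [->|/dot_gt0/ltW//] := eqVneq u 0; rewrite dot0l. Qed.

Lemma dnormE u : dnorm dot u ^+ 2 = dot u u.
Proof. by rewrite sqr_sqrtr ?dot_ge0. Qed.

Lemma dnorm_ge0 u : 0 <= dnorm dot u.
Proof. exact: sqrtr_ge0. Qed.

Lemma dot_cauchy_schwarz u v : dot u v <= dnorm dot u * dnorm dot v.
Proof.
have [->|/dot_gt0 v0] := eqVneq v 0.
  by rewrite dotC dot0l mulr_ge0 ?dnorm_ge0.
have h := dot_ge0 (dot v v *: u - dot u v *: v).
rewrite !dotE (dotC v u) in h.
have {}h : dot u v ^+ 2 <= dot u u * dot v v.
  rewrite -subr_ge0 -(pmulr_rge0 _ v0); apply: le_trans h _.
  by rewrite le_eqVlt; apply/orP; left; apply/eqP; ring.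
rewrite /dnorm -sqrtrM ?dot_ge0// (le_trans (ler_norm _))//.
by rewrite -sqrtr_sqr ler_wsqrtr.
Qed.

(** The weight [a] decides which of the two squares absorbs the cross term. *)
Lemma dot_young u v a : 0 < a ->
  2 * dot u v <= a * dot u u + a^-1 * dot v v.
Proof.
move=> a0; have h := dot_ge0 (a *: u - v).
rewrite !dotE (dotC v u) in h.
have {}h : 0 <= a^-1 * (a * (a * dot u u) - 2 * a * dot u v + dot v v).
  by apply: mulr_ge0; [rewrite invr_ge0 ltW | apply: le_trans h _; lra].
rewrite -subr_ge0; apply: le_trans h _; rewrite le_eqVlt; apply/orP; left.
by apply/eqP; field; rewrite gt_eqF.
Qed.

Lemma dot_sum2 u v : dot (u + v) (u + v) <= 2 * dot u u + 2 * dot v v.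
Proof. by have := dot_ge0 (u - v); rewrite !dotE (dotC v u); lra. Qed.

Lemma dot_sum3 u v w :
  dot (u + v + w) (u + v + w) <= 3 * dot u u + 3 * dot v v + 3 * dot w w.
Proof.
have := dot_ge0 (u - v); have := dot_ge0 (u - w); have := dot_ge0 (v - w).
by rewrite !dotE (dotC v u) (dotC w u) (dotC w v); lra.
Qed.

Lemma dot_convex u v a : 0 <= a <= 1 ->
  dot ((1 - a) *: u + a *: v) ((1 - a) *: u + a *: v)
    <= (1 - a) * dot u u + a * dot v v.
Proof.
move=> /andP[a0 a1]; have := dot_ge0 (u - v).
rewrite !dotE (dotC v u) => h.
have : 0 <= a * (1 - a) * (dot u u - dot u v + (- dot u v - - dot v v)).
  by rewrite !mulr_ge0//; lra.
lra.
Qed.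

End InnerProduct.

(** * Measurability of random vectors *)

Section VectorMeasurability.
Context {R : realType} {d : nat} (dot : {dot 'rV[R]_d for idfun}).

Definition measurable_vec dT (T : measurableType dT) (X : T -> 'rV[R]_d) :=
  forall j, measurable_fun [set: T] (fun w => X w 0 j).

Context dT (T : measurableType dT).
Implicit Types (X Y : T -> 'rV[R]_d).

Lemma measurable_vec_cst (x : 'rV[R]_d) : measurable_vec (fun _ : T => x).
Proof. by move=> j; exact: measurable_cst. Qed.

Lemma measurable_vecD X Y : measurable_vec X -> measurable_vec Y ->
  measurable_vec (fun w => X w + Y w).
Proof.
move=> mX mY j; under eq_fun do rewrite mxE.
exact: measurable_funD.
Qed.

Lemma measurable_vecZ (a : T -> R) X : measurable_fun setT a ->
  measurable_vec X -> measurable_vec (fun w => a w *: X w).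
Proof.
move=> ma mX j; under eq_fun do rewrite mxE.
exact: measurable_funM.
Qed.

Lemma measurable_vecN X : measurable_vec X -> measurable_vec (fun w => - X w).
Proof.
move=> mX j; under eq_fun do rewrite mxE.
exact: measurableT_comp.
Qed.

Lemma measurable_vecB X Y : measurable_vec X -> measurable_vec Y ->
  measurable_vec (fun w => X w - Y w).
Proof. by move=> mX mY; apply: measurable_vecD => //; exact: measurable_vecN. Qed.

Lemma measurable_vec_sum n (X : nat -> T -> 'rV[R]_d) :
  (forall i, measurable_vec (X i)) ->
  measurable_vec (fun w => \sum_(i < n) X i w).
Proof.
move=> mX; elim: n => [|n IH].
  by under eq_fun do rewrite big_ord0; exact: measurable_vec_cst.
by under eq_fun do rewrite big_ord_recr; exact: measurable_vecD.
Qed.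

Lemma measurable_vec_if (b : T -> bool) X Y : measurable_fun setT b ->
  measurable_vec X -> measurable_vec Y ->
  measurable_vec (fun w => if b w then X w else Y w).
Proof.
move=> mb mX mY j.
under eq_fun do rewrite (fun_if (fun x : 'rV[R]_d => x 0 j)).
exact: measurable_fun_ifT.
Qed.

Lemma measurable_dot X Y : measurable_vec X -> measurable_vec Y ->
  measurable_fun setT (fun w => dot (X w) (Y w)).
Proof.
move=> mX mY.
have E w : dot (X w) (Y w) = \sum_j X w 0 j * \sum_k Y w 0 k *
    dot (delta_mx 0 j) (delta_mx 0 k).
  rewrite {1}(row_sum_delta (X w)) dot_suml; apply: eq_bigr => j _.
  rewrite dotZl; congr (_ * _); rewrite dotC {1}(row_sum_delta (Y w)) dot_suml.
  by apply: eq_bigr => k _; rewrite dotZl dotC.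
rewrite (_ : (fun w => _) = fun w => \sum_j X w 0 j * \sum_k Y w 0 k *
    dot (delta_mx 0 j) (delta_mx 0 k)); last exact/funext.
apply: measurable_sum => j; apply: measurable_funM; first exact: mX.
apply: measurable_sum => k; apply: measurable_funM; [exact: mY|exact: measurable_cst].
Qed.

Lemma measurable_dnorm X : measurable_vec X ->
  measurable_fun setT (fun w => dnorm dot (X w)).
Proof.
move=> mX; apply: (measurableT_comp (continuous_measurable_fun (@sqrt_continuous R))).
exact: measurable_dot.
Qed.

(** A random index is harmless because it takes countably many values. *)
Lemma measurable_fun_nat_index dS (S : measurableType dS) (f : nat -> T -> S)
    (n : T -> nat) :
  (forall i, measurable_fun setT (f i)) -> measurable_fun setT n ->
  measurable_fun setT (fun w => f (n w) w).
Proof.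
move=> mf mn _ B mB; rewrite setTI.
rewrite (_ : _ @^-1` B = \bigcup_i (n @^-1` [set i] `&` f i @^-1` B)).
  apply: bigcupT_measurable => i; apply: measurableI.
    by rewrite -[X in measurable X]setTI; exact: mn.
  by rewrite -[X in measurable X]setTI; exact: mf.
apply/seteqP; split => [w Bw|w [i _ [/= <-]]//].
by exists (n w).
Qed.

Lemma measurable_vec_nat_index (X : nat -> T -> 'rV[R]_d) (n : T -> nat) :
  (forall i, measurable_vec (X i)) -> measurable_fun setT n ->
  measurable_vec (fun w => X (n w) w).
Proof.
move=> mX mn j; apply: (@measurable_fun_nat_index _ _ (fun i w => X i w 0 j)) => //.
by move=> i; exact: mX.
Qed.

Lemma nceil_le (x : R) n : (nceil x <= n)%N = (x <= n%:R).
Proof.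
rewrite /nceil -lez_nat gez0_abs ?ceil_ge0; last by rewrite (lt_le_trans (ltrN10 _))// le_max lexx.
by rewrite ceil_le_int ge_max ler0n.
Qed.

Lemma measurable_nceil (f : T -> R) : measurable_fun setT f ->
  measurable_fun setT (fun w => nceil (f w)).
Proof.
move=> mf _ B _; rewrite setTI.
rewrite (_ : _ @^-1` B =
    \bigcup_(m in B) [set w | nceil (f w) == m]); last first.
  apply/seteqP; split => [w Bw|w [m Bm /= /eqP ->]//].
  by exists (nceil (f w)) => //=.
apply: bigcup_measurable => m _.
rewrite (_ : [set w | _] = [set w | f w <= m%:R] `\`
   (if m is k.+1 then [set w | f w <= k%:R] else set0)); last first.
  apply/seteqP; split => [w /= /eqP|w /=].
    case: m => [|m] E; split => //; rewrite /= -nceil_le ?E//; lia.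
  case: m => [|m] /=; rewrite -!nceil_le => -[H1 H2]; apply/eqP; first by lia.
  by move/negP: H2; lia.
have ml (t : R) : measurable [set w | f w <= t].
  rewrite (_ : [set w | _] = f @^-1` `]-oo, t]); last first.
    by apply/seteqP; split => w /=; rewrite in_itv.
  by rewrite -[X in measurable X]setTI; exact: mf.
by apply: measurableD => //; case: m.
Qed.

End VectorMeasurability.

(** * Independence and conditioning *)

Section Freezing.
Local Open Scope ereal_scope.
Context {R : realType}.

(** The joint law of two independent variables is the product of their laws, so
    that Tonelli's theorem integrates the second one out while the first one is
    held fixed. *)
Lemma ge0_integral_independent dT dS dU (T : measurableType dT)
    (S : measurableType dS) (U : measurableType dU)
    (P : probability T R) (Q : probability U R) (f : T -> S) (Y : T -> U)
    (g : S * U -> \bar R) :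
  measurable_fun setT f -> measurable_fun setT Y ->
  (forall A B, measurable A -> measurable B ->
    P (f @^-1` A `&` Y @^-1` B) = P (f @^-1` A) * Q B) ->
  measurable_fun setT g -> (forall x, 0 <= g x) ->
  \int[P]_w g (f w, Y w) = \int[P]_w \int[Q]_y g (f w, y).
Proof.
move=> mf mY indep mg g0.
pose fM : {mfun T >-> S} := HB.pack f (isMeasurableFun.Build _ _ _ _ _ mf).
have mfY : measurable_fun setT (fun w => (f w, Y w)) by exact: measurable_fun_pair.
pose fY : {mfun T >-> (S * U)%type} :=
  HB.pack (fun w => (f w, Y w)) (isMeasurableFun.Build _ _ _ _ _ mfY).
transitivity (\int[distribution P fY]_x g x).
  by rewrite ge0_integral_distribution.
transitivity (\int[distribution P fM \x Q]_x g x).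
  apply: eq_measure_integral => A mA _.
  by apply/esym/product_measure_unique => // B C mB mC; exact: indep.
rewrite fubini_tonelli1//.
have mF : measurable_fun setT (fubini_F Q g) by exact: measurable_fun_fubini_tonelli_F.
rewrite ge0_integral_distribution// => y.
by apply: integral_ge0 => u _.
Qed.

End Freezing.

Section Information.
Local Open Scope ereal_scope.
Context {R : realType} {dO : measure_display} {Omega : measurableType dO}.
Context (P : probability Omega R).
Context {dZ : measure_display} {Z : measurableType dZ}.
Context (z : nat -> nat -> nat -> {RV P >-> Z}) (c : nat -> nat -> {RV P >-> bool}).

Local Notation index := ((nat * nat * nat) + (nat * nat))%type.
Implicit Types I J : pred index.

Definition events_of I : set (set Omega) :=
  [set A | exists2 i, I i & randomness_sigma z c i A].

(** The sample space carrying only the events decided by the draws in [I]: a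
    random variable is determined by these draws when it is measurable on it. *)
Definition known I := g_sigma_algebraType (events_of I).

Lemma randomness_sigma_measurable i A :
  randomness_sigma z c i A -> measurable A.
Proof.
by case: i => [[[n k] j]|[n k]] [B mB <-]; exact: measurable_funPT.
Qed.

Lemma known_measurable I (A : set (known I)) :
  measurable A -> @measurable _ Omega A.
Proof.
apply: (smallest_sub (@sigma_algebra_measurable _ Omega)) => B [i _].
exact: randomness_sigma_measurable.
Qed.

Lemma measurable_known_id I : measurable_fun setT (id : Omega -> known I).
Proof. by move=> _ A mA; rewrite setTI; exact: known_measurable mA. Qed.

Lemma known_fun I dS (S : measurableType dS) (f : known I -> S) :
  measurable_fun setT f -> measurable_fun setT (f : Omega -> S).
Proof.
by move=> mf _ A mA; rewrite setTI -[_ @^-1` _]setTI; apply: (@known_measurable I); exact: mf.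
Qed.

Lemma known_sub I J (A : set Omega) : (forall i, I i -> J i) ->
  @measurable _ (known I) A -> @measurable _ (known J) A.
Proof.
move=> IJ; apply: sub_sigma_algebra2 => B [i Ii Bi].
by exists i => //; exact: IJ.
Qed.

Lemma known_fun_sub I J dS (S : measurableType dS) (f : Omega -> S) :
  (forall i, I i -> J i) ->
  measurable_fun setT (f : known I -> S) -> measurable_fun setT (f : known J -> S).
Proof.
by move=> IJ mf _ A mA; rewrite setTI -[_ @^-1` _]setTI; apply: (known_sub IJ); exact: mf.
Qed.

Lemma known_sample I n k j : I (inl (n, k, j)) ->
  measurable_fun setT (z n k j : known I -> Z).
Proof.
move=> Ii _ A mA; rewrite setTI; apply: sub_sigma_algebra.
by exists (inl (n, k, j)) => //; exists A => //; rewrite setTI.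
Qed.

Lemma known_coin I n k : I (inr (n, k)) ->
  measurable_fun setT (c n k : known I -> bool).
Proof.
move=> Ii _ A mA; rewrite setTI; apply: sub_sigma_algebra.
by exists (inr (n, k)) => //; exists A => //; rewrite setTI.
Qed.

Let randomness_sigmaT i : randomness_sigma z c i setT.
Proof. by case: i => [[[n k] j]|[n k]]; exists setT; rewrite ?preimage_setT ?setTI. Qed.

Let randomness_sigmaI i A B : randomness_sigma z c i A ->
  randomness_sigma z c i B -> randomness_sigma z c i (A `&` B).
Proof.
by case: i => [[[n k] j]|[n k]] [A' mA <-] [B' mB <-]; exists (A' `&` B');
  rewrite ?preimage_setI -?setIIr//; exact: measurableI.
Qed.

Hypothesis indep : mutually_independent P (randomness_sigma z c).

(* finite intersections of elementary events *)
Let cylinders I : set (set Omega) :=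
  [set A | exists s (E : index -> set Omega),
    [/\ uniq s, forall i, i \in s -> I i /\ randomness_sigma z c i (E i) &
        A = \bigcap_(i in [set` s]) E i]].

Let cylindersI I : setI_closed (cylinders I).
Proof.
move=> _ _ [s [E [us sE ->]]] [t [F [ut tF ->]]].
pose G i := (if i \in s then E i else setT) `&` (if i \in t then F i else setT).
exists (undup (s ++ t)), G; split; first exact: undup_uniq.
  move=> i; rewrite mem_undup mem_cat => ist; split.
    by case/orP: ist => [/sE[]|/tF[]].
  apply: randomness_sigmaI; case: ifPn => [is_|_]; try exact: randomness_sigmaT.
    by have [] := sE _ is_.
  by have [] := tF _ is_.
apply/seteqP; split => [w [sw tw] i /=|w Gw].
  by rewrite mem_undup mem_cat => _; split; case: ifPn => // ?; [exact: sw|exact: tw].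
split => i /= ii.
  by have := Gw i; rewrite /= mem_undup mem_cat ii => /(_ isT)[]; rewrite ii.
by have := Gw i; rewrite /= mem_undup mem_cat ii orbT => /(_ isT)[_]; rewrite ii.
Qed.

(** The finite intersections of elementary events are stable under intersection
    and generate the known events.  On them independence is the product rule, so
    the two sides, which are measures of [A], agree on all known events. *)
Lemma known_independent I i (A B : set Omega) : ~~ I i ->
  @measurable _ (known I) A -> randomness_sigma z c i B ->
  P (A `&` B) = P A * P B.
Proof.
move=> Ii mA Bi.
have mB := randomness_sigma_measurable Bi.
have PB : (0 <= fine (P B))%R by rewrite fine_ge0.
have key : forall A, <<s cylinders I >> A -> mrestr P mB A = mscale (NngNum PB) P A.
  have mC : cylinders I `<=` measurable.
    move=> _ [s [E [_ sE ->]]]; rewrite bigcap_seq big_seq; apply: bigsetI_measurable => j js.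
    by have [_] := sE _ js; exact: randomness_sigma_measurable.
  apply: (g_sigma_algebra_measure_unique _ mC (fun=> setT)).
  - move=> _; exists [::], (fun=> setT); split => //.
    by apply/seteqP; split.
  - by rewrite bigcup_const//; exists 0%N.
  - exact: cylindersI.
  - move=> _ [s [E [us sE ->]]].
    change (P (\bigcap_(i in [set` s]) E i `&` B) =
      (fine (P B))%:E * P (\bigcap_(i in [set` s]) E i)).
    rewrite fineK ?fin_num_measure//.
    have is_ : i \notin s by apply: contraNN Ii => /sE[].
    pose E' j := if j == i then B else E j.
    have eqE j : j \in s -> E' j = E j.
      by move=> js; rewrite /E'; case: eqP => // ji; move: is_; rewrite -ji js.
    have -> : \bigcap_(i in [set` s]) E i `&` B = \bigcap_(j in [set` i :: s]) E' j.
      apply/seteqP; split => [w [sw Bw] j /=|w Gw].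
        rewrite inE => /predU1P[->|js]; first by rewrite /E' eqxx.
        by rewrite eqE//; exact: sw.
      split=> [j /= js|].
        by rewrite -eqE//; apply: Gw; rewrite /= inE js orbT.
      by have := Gw i; rewrite /E' eqxx; apply; rewrite /= inE eqxx.
    rewrite indep; [|by rewrite /= is_|].
      rewrite big_cons {1}/E' eqxx; congr (_ * _).
      rewrite indep//; last by move=> j /sE[].
      by rewrite big_seq [RHS]big_seq; apply: eq_bigr => j /eqE ->.
    move=> j; rewrite inE /E'; case: eqP => [-> _//|_ /= /sE[]//].
  - by move=> _; rewrite (le_lt_trans (probability_le1 P _)) ?ltry//; exact: measurableI.
have {}mA : <<s cylinders I >> A.
  apply: sub_sigma_algebra2 mA => C [j Ij Cj].
  exists [:: j], (fun=> C); split => //; first by move=> k; rewrite inE => /eqP ->.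
  by rewrite bigcap_seq big_seq1.
transitivity ((fine (P B))%:E * P A); first exact: (key _ mA).
by rewrite fineK ?fin_num_measure// muleC.
Qed.

End Information.

Section Draws.
Local Open Scope ereal_scope.
Context {R : realType} {dO : measure_display} {Omega : measurableType dO}.
Context (P : probability Omega R).
Context {dZ : measure_display} {Z : measurableType dZ} (Pz : probability Z R).
Context (z : nat -> nat -> nat -> {RV P >-> Z}) (c : nat -> nat -> {RV P >-> bool}).
Hypothesis rnd : algorithm_randomness Pz z c.

(** A sample that is not yet known is integrated out first. *)
Lemma ge0_integral_sample I n k j (g : known z c I * Z -> \bar R) :
  ~~ I (inl (n, k, j)) -> measurable_fun setT g -> (forall x, 0 <= g x) ->
  \int[P]_w g (w, z n k j w) = \int[P]_w \int[Pz]_y g (w, y).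
Proof.
move=> Ii mg g0.
apply: (@ge0_integral_independent _ _ _ _ Omega (known z c I) Z P Pz id (z n k j)
  g (@measurable_known_id _ _ _ _ _ _ z c I)) => //.
move=> A B mA mB.
rewrite (known_independent (samples_coins_independent rnd) Ii mA); last first.
  by exists B => //; rewrite setTI.
by rewrite -(sample_law rnd n k j mB).
Qed.

Lemma ge0_integral_coin I n k (h : known z c I -> \bar R) (b : bool) :
  (0 < k)%N -> ~~ I (inr (n, k)) -> measurable_fun setT h -> (forall x, 0 <= h x) ->
  \int[P]_w ((c n k w == b)%:R%:E * h w) =
    (if b then coin_prob k else 1 - coin_prob k)%:E * \int[P]_w h w.
Proof.
move=> k0 Ii mh h0.
pose g (x : known z c I * bool) : \bar R := (x.2 == b)%:R%:E * h x.1.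
have mg : measurable_fun setT g.
  apply: emeasurable_funM; last exact: measurableT_comp.
  exact: (measurableT_comp (f := fun y : bool => (y == b)%:R%:E)).
have g0 x : 0 <= g x by rewrite mule_ge0 ?lee_fin.
have Plaw : P [set w | c n k w = b] = (if b then coin_prob k else 1 - coin_prob k)%:E.
  case: (b); first exact: (coin_law rnd n k0).
  rewrite (_ : [set w | _] = ~` [set w | c n k w]); last first.
    by apply/seteqP; split => w /=; case: (c n k w).
  rewrite probability_setC ?(coin_law rnd n k0)//.
  rewrite (_ : [set w | _] = c n k @^-1` [set true])//.
  by rewrite -[X in measurable X]setTI; exact: measurable_funPT.
rewrite [LHS](@ge0_integral_independent _ _ _ _ Omega (known z c I) _ P
  (distribution P (c n k)) id (c n k) g (@measurable_known_id _ _ _ _ _ _ z c I))//=.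
  transitivity (\int[P]_w (distribution P (c n k) [set b] * h w)).
    apply: eq_integral => w _; rewrite /g /=.
    under eq_integral do rewrite muleC.
    rewrite ge0_integralZl//=.
    rewrite [RHS]muleC; congr (_ * _); rewrite -[RHS]mul1e -integral_cst//= [RHS]integral_mkcond.
    apply: eq_integral => x _; rewrite patchE.
    by case: ifPn => [/set_mem ->|/negP xb]; rewrite ?eqxx//; case: eqP => // xb'; case: xb; rewrite xb' inE.
  rewrite ge0_integralZl//=; last exact: known_fun mh.
  by rewrite -Plaw.
move=> A B mA mB.
rewrite (known_independent (samples_coins_independent rnd) Ii mA)//.
by exists B => //; rewrite setTI.
Qed.

End Draws.

(** * Second moments of the oracle and of its batches *)

Section SecondMoment.
Context {R : realType} {d : nat} (dot : {dot 'rV[R]_d for idfun}).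
Context {dU : measure_display} {U : measurableType dU} (Q : probability U R).

(** The deviation [H - h] has mean zero, so its cross term with [a] vanishes, and
    its second moment is at most that of [H]. *)
Lemma second_moment_centered (H : U -> 'rV[R]_d) (h a : 'rV[R]_d) (s b : R) :
  measurable_vec H ->
  (forall j, (\int[Q]_y (H y 0 j)%:E = (h 0 j)%:E)%E) ->
  (\int[Q]_y (dot (H y) (H y))%:E <= b%:E)%E ->
  (\int[Q]_y (dot (a + s *: (H y - h)) (a + s *: (H y - h)))%:E
     <= (dot a a + s ^+ 2 * b)%:E)%E.
Proof.
move=> mH mean Hb.
(* in terms of [x] the integrand is a quadratic polynomial in [H] alone *)
have [x ax] : exists x, a = x + s *: h by exists (a - s *: h); rewrite subrK.
have intH j : Q.-integrable setT (fun y => (H y 0 j)%:E).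
  apply/integrableP; split; first exact/measurable_EFinP/mH.
  by rewrite integral_fin_num_abs// mean.
have dotxE v : dot x v = \sum_j dot x (delta_mx 0 j) * v 0 j.
  rewrite {1}(row_sum_delta v) dotC dot_suml; apply: eq_bigr => j _.
  by rewrite dotZl mulrC dotC.
have intx : Q.-integrable setT (fun y => (dot x (H y))%:E).
  rewrite (_ : (fun _ => _) =
    fun y => (\sum_j ((dot x (delta_mx 0 j))%:E * (H y 0 j)%:E))%E); last first.
    by apply/funext => y; rewrite dotxE -sumEFin.
  by apply: integrable_sum => // j _; exact: integrableZl.
have meanx : (\int[Q]_y (dot x (H y))%:E = (dot x h)%:E)%E.
  under eq_integral do rewrite dotxE -sumEFin.
  under eq_integral do under eq_bigr do rewrite EFinM.
  rewrite integral_sum//; last by move=> j; exact: integrableZl.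
  by rewrite dotxE -sumEFin; apply: eq_bigr => j _; rewrite integralZl// mean.
have mHH : measurable_fun setT (fun y => (dot (H y) (H y))%:E).
  exact/measurable_EFinP/measurable_dot.
have intHH : Q.-integrable setT (fun y => (dot (H y) (H y))%:E).
  apply/integrableP; split => //; under eq_integral do rewrite gee0_abs ?lee_fin ?dot_ge0//.
  by rewrite (le_lt_trans Hb)// ltry.
have E y : (dot (a + s *: (H y - h)) (a + s *: (H y - h)))%:E =
  ((dot x x)%:E + (2 * s)%:E * (dot x (H y))%:E + (s ^+ 2)%:E * (dot (H y) (H y))%:E)%E.
  have -> : a + s *: (H y - h) = x + s *: H y by rewrite ax scalerBr -addrA [s *: h + _]addrC subrK.
  rewrite -!EFinM -!EFinD; congr _%:E; move: (x) (H y) => v w.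
  by rewrite !dotE (dotC dot w v); ring.
under eq_integral do rewrite E.
have intc : Q.-integrable setT (fun _ => (dot x x)%:E) by exact: finite_measure_integrable_cst.
rewrite integralD//; last 2 first.
- by apply: integrableD => //; exact: integrableZl.
- exact: integrableZl.
rewrite integralD//; last exact: integrableZl.
rewrite !integralZl// meanx integral_cst// [X in (_ * X)%E]probability_setT mule1.
apply: (@le_trans _ _ ((dot x x)%:E + (2 * s)%:E * (dot x h)%:E + (s ^+ 2)%:E * b%:E)%E).
  by apply: leeD2l; apply: lee_wpmul2l => //; rewrite lee_fin sqr_ge0.
rewrite -!EFinM -!EFinD lee_fin.
rewrite ax.
have := mulr_ge0 (sqr_ge0 s) (dot_ge0 dot h).
by rewrite !dotE (dotC dot h x); lra.
Qed.

End SecondMoment.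

Section Oracle.
Context {R : realType} {d : nat} (dot : {dot 'rV[R]_d for idfun}).
Context {dZ : measure_display} {Z : measurableType dZ} (Pz : probability Z R).
Context (F : 'rV[R]_d -> 'rV[R]_d) (Fhat : 'rV[R]_d -> Z -> 'rV[R]_d) (sigma L : R).
Hypothesis oracle : stochastic_oracle dot Pz F Fhat sigma L.

Lemma measurable_oracle dT (T : measurableType dT) (X : T -> 'rV[R]_d) (Y : T -> Z) :
  measurable_vec X -> measurable_fun setT Y ->
  measurable_vec (fun w => Fhat (X w) (Y w)).
Proof.
move=> mX mY j.
pose p w : d.-tuple R * Z := ([tuple X w 0 i | i < d], Y w).
have mp : measurable_fun setT p.
  apply: measurable_fun_pair => //; apply/measurable_fun_tnthP => i.
  rewrite (_ : _ \o _ = fun w => X w 0 i); first exact: mX.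
  by apply/funext => w /=; rewrite tnth_mktuple.
have := measurableT_comp (oracle_measurable oracle j) mp.
apply: eq_measurable_fun => w _ /=; congr (Fhat _ _ 0 j).
by apply/rowP => i; rewrite mxE tnth_mktuple.
Qed.

Lemma oracle_mean x j : (\int[Pz]_y (Fhat x y 0 j)%:E = (F x 0 j)%:E)%E.
Proof. by have := oracle_unbiased oracle x j; rewrite unlock. Qed.

(** The mean is a parametric integral of the oracle, whence its measurability. *)
Lemma measurable_operator dT (T : measurableType dT) (X : T -> 'rV[R]_d) :
  measurable_vec X -> measurable_vec (fun w => F (X w)).
Proof.
move=> mX j.
pose g (x : T * Z) := (Fhat (X x.1) x.2 0 j)%:E.
have mg : measurable_fun setT g.
  apply/measurable_EFinP; apply: measurable_oracle => // i.
  exact: (measurableT_comp (mX i)).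
rewrite (_ : (fun w => _) =
    fine \o (fun w => fubini_F Pz (g^\+)%E w - fubini_F Pz (g^\-)%E w)%E); last first.
  apply/funext => w /=; have := oracle_mean (X w) j.
  rewrite integralE => E; rewrite -[LHS]/(fine (F (X w) 0 j)%:E) -E /fubini_F.
  by congr (fine (_ - _)%E); apply: eq_integral => y _; rewrite !(funeposE, funenegE).
apply: measurableT_comp => //; apply: emeasurable_funB.
  by apply: measurable_fun_fubini_tonelli_F => //; exact: measurable_funepos.
by apply: measurable_fun_fubini_tonelli_F => //; exact: measurable_funeneg.
Qed.

Lemma measurable_sample_mean dT (T : measurableType dT) (S : T -> nat)
    (G : T -> Z -> 'rV[R]_d) (Y : nat -> T -> Z) :
  measurable_fun setT S ->
  (forall i, measurable_vec (fun w => G w (Y i w))) ->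
  measurable_vec (fun w => sample_mean (S w) (G w) (Y^~ w)).
Proof.
move=> mS mG.
refine (measurable_vec_nat_index
  (X := fun n w => sample_mean n (G w) (Y^~ w)) _ mS) => n.
refine (measurable_vecZ (a := fun=> n%:R^-1) (measurable_cst _) _).
exact: (@measurable_vec_sum R d _ T n (fun i w => G w (Y i w))).
Qed.

Lemma oracle_second_moment x :
  (\int[Pz]_y (dot (Fhat x y - F x) (Fhat x y - F x))%:E <= (sigma ^+ 2)%:E)%E.
Proof.
have := oracle_variance oracle x; rewrite unlock.
by under eq_integral do rewrite dnormE.
Qed.

Lemma oracle_increment_second_moment x x' :
  (\int[Pz]_y (dot (Fhat x y - Fhat x' y) (Fhat x y - Fhat x' y))%:E
     <= (L ^+ 2 * dot (x - x') (x - x'))%:E)%E.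
Proof.
have := oracle_lipschitz oracle x x'; rewrite unlock dnormE.
by under eq_integral do rewrite dnormE.
Qed.

Lemma integral_vecB (H G : Z -> 'rV[R]_d) (h g : 'rV[R]_d) j :
  measurable_vec H -> measurable_vec G ->
  (\int[Pz]_y (H y 0 j)%:E = (h 0 j)%:E)%E ->
  (\int[Pz]_y (G y 0 j)%:E = (g 0 j)%:E)%E ->
  (\int[Pz]_y ((H y - G y) 0 j)%:E = ((h - g) 0 j)%:E)%E.
Proof.
move=> mH mG Hh Gg.
have int (K : Z -> 'rV[R]_d) k : measurable_vec K ->
    (\int[Pz]_y (K y 0 j)%:E = k%:E)%E -> Pz.-integrable setT (fun y => (K y 0 j)%:E).
  move=> mK Kk; apply/integrableP; split; first exact/measurable_EFinP/mK.
  by rewrite integral_fin_num_abs// Kk.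
under eq_integral do rewrite !mxE EFinB.
by rewrite integralB_EFin ?Hh ?Gg ?mxE//; [apply: int Hh|apply: int Gg].
Qed.

End Oracle.

Section BatchError.
Context {R : realType} {d : nat} (dot : {dot 'rV[R]_d for idfun}).
Context {dO : measure_display} {Omega : measurableType dO} (P : probability Omega R).
Context {dZ : measure_display} {Z : measurableType dZ} (Pz : probability Z R).
Context (z : nat -> nat -> nat -> {RV P >-> Z}) (c : nat -> nat -> {RV P >-> bool}).
Hypothesis rnd : algorithm_randomness Pz z c.
Implicit Types I : pred ((nat * nat * nat) + (nat * nat)).

Let norm2 (u : 'rV[R]_d) := dot u u.

(** The samples of the batch are integrated out one at a time.  Given what is
    known before it is drawn, a sample has a deviation [H w y - h w] of mean zero,
    so it only adds its own second moment.  All the integrands on [Omega] are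
    nonnegative, so that Tonelli's theorem applies; the cross terms only occur in
    the inner integrals, over [Z].  The weight [W] serves to restrict to an event,
    such as an outcome of the coin. *)
Lemma fixed_batch_second_moment I n k m (W s B : Omega -> R)
    (a h : Omega -> 'rV[R]_d) (H : Omega -> Z -> 'rV[R]_d) :
  (forall j, ~~ I (inl (n, k, j))) ->
  measurable_fun setT (W : known z c I -> R) -> (forall w, 0 <= W w) ->
  measurable_fun setT (s : known z c I -> R) ->
  measurable_fun setT (B : known z c I -> R) ->
  measurable_vec (a : known z c I -> _) -> measurable_vec (h : known z c I -> _) ->
  measurable_vec (fun x : known z c I * Z => H x.1 x.2) ->
  (forall w j, (\int[Pz]_y (H w y 0 j)%:E = (h w 0 j)%:E)%E) ->
  (forall w, (\int[Pz]_y (dot (H w y) (H w y))%:E <= (B w)%:E)%E) ->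
  (\int[P]_w (W w * norm2 (a w + s w *: \sum_(i < m) (H w (z n k i w) - h w)))%:E
     <= \int[P]_w (W w * (norm2 (a w) + m%:R * (s w ^+ 2 * B w)))%:E)%E.
Proof.
move=> Ij mW W0 ms mB ma mh mH mean HB.
have B0 w : 0 <= B w.
  rewrite -lee_fin (le_trans _ (HB w))// integral_ge0// => y _.
  by rewrite lee_fin dot_ge0.
elim: m => [|m IHm].
  by under eq_integral do rewrite big_ord0 scaler0 addr0;
     under [leRHS]eq_integral do rewrite mul0r addr0.
(* what is known after the first [m] samples of the batch *)
pose J i := I i || [exists j : 'I_m, i == inl (n, k, nat_of_ord j)].
have IJ i : I i -> J i by rewrite /J => ->.
have mH' dT (T : measurableType dT) (X : T -> known z c I) (Y : T -> Z) :
    measurable_fun setT X -> measurable_fun setT Y ->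
    measurable_vec (fun w => H (X w) (Y w)).
  by move=> mX mY j; exact: (measurableT_comp (mH j) (measurable_fun_pair mX mY)).
have JI : measurable_fun setT (id : known z c J -> known z c I).
  exact: (known_fun_sub IJ (@measurable_id _ (known z c I) setT)).
pose a' (w : known z c J) := a w + s w *: \sum_(i < m) (H w (z n k i w) - h w).
have ma' : measurable_vec a'.
  apply: measurable_vecD; first by move=> j; exact: (known_fun_sub IJ (ma j)).
  apply: measurable_vecZ; first exact: (known_fun_sub IJ ms).
  rewrite /measurable_vec => j.
  under eq_fun do rewrite summxE.
  apply: measurable_sum => i.
  have := @measurable_vecB R d _ (known z c J) (fun w => H w (z n k i w)) h.
  apply.
    apply: (mH' _ (known z c J) id (z n k i)) => //.
    by apply: known_sample; rewrite /J; apply/orP; right; apply/existsP; exists i.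
  by move=> l; exact: (known_fun_sub IJ (mh l)).
pose g (x : known z c J * Z) : \bar R :=
  (W x.1 * norm2 (a' x.1 + s x.1 *: (H x.1 x.2 - h x.1)))%:E.
have comp1 (f : Omega -> R) : measurable_fun setT (f : known z c I -> R) ->
    measurable_fun setT (fun x : known z c J * Z => f x.1).
  move=> mf; exact: (measurableT_comp (known_fun_sub IJ mf) measurable_fst).
have mg : measurable_fun setT g.
  apply/measurable_EFinP; apply: measurable_funM; first exact: comp1.
  suff mga : measurable_vec (fun x : known z c J * Z =>
    a' x.1 + s x.1 *: (H x.1 x.2 - h x.1)) by exact: measurable_dot.
  apply: measurable_vecD.
    by move=> j; exact: (measurableT_comp (ma' j) measurable_fst).
  apply: measurable_vecZ; first exact: comp1.
  apply: measurable_vecB; last by move=> j; exact: (comp1 _ (mh j)).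
  apply: (mH' _ _ (fun x : known z c J * Z => x.1) snd) => //.
  exact: (measurableT_comp JI measurable_fst).
have g0 x : (0 <= g x)%E by rewrite lee_fin mulr_ge0// dot_ge0.
have Jm : ~~ J (inl (n, k, m)).
  rewrite /J negb_or Ij/=; apply/existsPn => j; apply/eqP => -[] /esym/eqP.
  by rewrite ltn_eqF.
have mtop (f : Omega -> R) : measurable_fun setT (f : known z c I -> R) ->
    measurable_fun setT f.
  exact: known_fun.
have mvtop (f : Omega -> 'rV[R]_d) : measurable_vec (f : known z c I -> 'rV[R]_d) ->
    measurable_vec f.
  by move=> mf j; exact: known_fun (mf j).
have ma'top : measurable_vec (a' : Omega -> _).
  by move=> j; exact: known_fun (ma' j).
apply: (@le_trans _ _ (\int[P]_w (W w * (norm2 (a' w) + s w ^+ 2 * B w))%:E)%E).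
  rewrite (eq_integral (fun w => g (w, z n k m w))); last first.
    by move=> w _; rewrite /g /a' /= big_ord_recr /= scalerDr addrA.
  rewrite (ge0_integral_sample rnd Jm mg g0).
  apply: ge0_le_integral => //.
  - by move=> w _; exact: integral_ge0.
  - have := measurable_fun_fubini_tonelli_F (m2 := Pz) g mg g0.
    exact: known_fun.
  - apply/measurable_EFinP; apply: measurable_funM; first exact: mtop.
    apply: measurable_funD; first exact: measurable_dot.
    by apply: measurable_funM; [apply: measurable_funX; exact: mtop|exact: mtop].
  move=> w _; rewrite /g /=.
  under eq_integral do rewrite EFinM.
  rewrite ge0_integralZl//=; last 3 first.
  - apply/measurable_EFinP; apply: measurable_dot;
      (apply: measurable_vecD; first exact: measurable_vec_cst);
      (apply: (@measurable_vecZ _ _ _ _ (fun=> s w)); first exact: measurable_cst);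
      (apply: measurable_vecB; last exact: measurable_vec_cst);
      exact: (mH' _ _ (cst w) id).
  - by move=> y _; rewrite lee_fin dot_ge0.
  - by rewrite lee_fin.
  rewrite EFinM lee_wpmul2l ?lee_fin//.
  apply: second_moment_centered => //.
  exact: (mH' _ _ (cst w) id).
have mN : measurable_fun setT (fun w => W w * (s w ^+ 2 * B w)).
  apply: measurable_funM; first exact: mtop.
  by apply: measurable_funM; [apply: measurable_funX; exact: mtop|exact: mtop].
have N0 w : 0 <= W w * (s w ^+ 2 * B w) by rewrite mulr_ge0// mulr_ge0 ?sqr_ge0.
have split (f : Omega -> R) : measurable_fun setT f -> (forall w, 0 <= f w) ->
  (\int[P]_w (W w * (f w + s w ^+ 2 * B w))%:E =
   \int[P]_w (W w * f w)%:E + \int[P]_w (W w * (s w ^+ 2 * B w))%:E)%E.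
  move=> mf f0; rewrite -ge0_integralD//.
  - by apply: eq_integral => w _; rewrite mulrDr EFinD.
  - by move=> w _; rewrite lee_fin mulr_ge0.
  - by apply/measurable_EFinP; apply: measurable_funM => //; exact: mtop.
  - by move=> w _; rewrite lee_fin.
  - exact/measurable_EFinP.
rewrite split; last 2 first.
- exact: measurable_dot.
- by move=> w; exact: dot_ge0.
rewrite [leRHS](_ : _ = \int[P]_w (W w * ((norm2 (a w) +
    m%:R * (s w ^+ 2 * B w)) + s w ^+ 2 * B w))%:E)%E; last first.
  by apply: eq_integral => w _; rewrite -addrA -[in m.+1%:R]addn1 natrD mulrDl mul1r.
rewrite split ?leeD2r//.
- apply: measurable_funD; first by apply: measurable_dot; exact: mvtop.
  apply: measurable_funM; first exact: measurable_cst.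
  by apply: measurable_funM; [apply: measurable_funX; exact: mtop|exact: mtop].
- by move=> w; rewrite addr_ge0 ?dot_ge0// mulr_ge0// mulr_ge0 ?sqr_ge0.
Qed.

Lemma integral_by_count (S : Omega -> nat) (f : Omega -> \bar R) :
  measurable_fun setT S -> measurable_fun setT f -> (forall w, (0 <= f w)%E) ->
  (\int[P]_w f w = \sum_(m <oo) \int[P]_w ((S w == m)%:R%:E * f w))%E.
Proof.
move=> mS mf f0.
have mSm m : measurable (S @^-1` [set m]).
  by rewrite -[X in measurable X]setTI; exact: mS.
have cover : \bigcup_m (S @^-1` [set m]) = setT.
  by apply/seteqP; split => w // _; exists (S w).
rewrite -cover ge0_integral_bigcup//; last 2 first.
- by apply: measurable_funS mf.
- by apply/trivIsetP => i j _ _ ij; apply/seteqP; split => w //= [-> /eqP]; apply/negP.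
apply: eq_eseriesr => m _; rewrite integral_mkcond cover; apply: eq_integral => w _.
rewrite patchE; case: ifPn => [/set_mem /= ->|/negP Sm]; first by rewrite eqxx mul1e.
by case: eqP => [E|_]; rewrite ?mul0e//; case: Sm; rewrite inE.
Qed.

(** The size of the batch may depend on what is known before it is drawn: on each
    event fixing the size, the batch has a fixed size. *)
Lemma batch_second_moment I n k (W B : Omega -> R) (S : Omega -> nat)
    (a h : Omega -> 'rV[R]_d) (H : Omega -> Z -> 'rV[R]_d) :
  (forall j, ~~ I (inl (n, k, j))) ->
  measurable_fun setT (W : known z c I -> R) -> (forall w, 0 <= W w) ->
  measurable_fun setT (S : known z c I -> nat) ->
  measurable_fun setT (B : known z c I -> R) ->
  measurable_vec (a : known z c I -> _) -> measurable_vec (h : known z c I -> _) ->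
  measurable_vec (fun x : known z c I * Z => H x.1 x.2) ->
  (forall w j, (\int[Pz]_y (H w y 0 j)%:E = (h w 0 j)%:E)%E) ->
  (forall w, (\int[Pz]_y (dot (H w y) (H w y))%:E <= (B w)%:E)%E) ->
  (\int[P]_w (W w * norm2 (a w +
       (S w)%:R^-1 *: \sum_(i < S w) (H w (z n k i w) - h w)))%:E
     <= \int[P]_w (W w * (norm2 (a w) + (S w)%:R^-1 * B w))%:E)%E.
Proof.
move=> Ij mW W0 mS mB ma mh mH mean HB.
have B0 w : 0 <= B w.
  rewrite -lee_fin (le_trans _ (HB w))// integral_ge0// => y _.
  by rewrite lee_fin dot_ge0.
have mtop dS (T : measurableType dS) (f : Omega -> T) :
    measurable_fun setT (f : known z c I -> T) -> measurable_fun setT f.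
  exact: known_fun.
have mSinv : measurable_fun setT (fun w => (S w)%:R^-1 : R).
  by apply: (measurableT_comp (f := fun m => m%:R^-1 : R)) => //; exact: mtop.
have mv (f : Omega -> 'rV[R]_d) : measurable_vec (f : known z c I -> 'rV[R]_d) ->
    measurable_vec f.
  by move=> mf j; exact: known_fun (mf j).
have msum m : measurable_vec (fun w => \sum_(i < m) (H w (z n k i w) - h w)).
  apply: (@measurable_vec_sum _ _ _ _ m (fun i w => H w (z n k i w) - h w)) => i.
  apply: measurable_vecB; last exact: mv.
  move=> j; have mid := @measurable_known_id _ _ _ P _ _ z c I.
  by have := measurableT_comp (mH j)
    (measurable_fun_pair mid (@measurable_funPT _ _ _ _ (z n k i))); exact.
rewrite (integral_by_count (S := S)); last 3 first.
- exact: mtop.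
- apply/measurable_EFinP; apply: measurable_funM; first exact: mtop.
  have mres : measurable_vec (fun w => a w +
       (S w)%:R^-1 *: \sum_(i < S w) (H w (z n k i w) - h w)).
    apply: measurable_vecD; first exact: mv.
    apply: measurable_vecZ => //.
    apply: (@measurable_vec_nat_index _ _ _ _
      (fun m w => \sum_(i < m) (H w (z n k i w) - h w)) S) => //.
    exact: mtop.
  exact: measurable_dot.
- by move=> w; rewrite lee_fin mulr_ge0// dot_ge0.
rewrite [leRHS](integral_by_count (S := S)); last 3 first.
- exact: mtop.
- apply/measurable_EFinP; apply: measurable_funM; first exact: mtop.
  apply: measurable_funD; first by apply: measurable_dot; exact: mv.
  by apply: measurable_funM => //; exact: mtop.
- by move=> w; rewrite lee_fin mulr_ge0// addr_ge0 ?dot_ge0// mulr_ge0// invr_ge0.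
apply: lee_nneseries => m _.
  by move=> _; apply: integral_ge0 => w _; rewrite mule_ge0// lee_fin// mulr_ge0// dot_ge0.
pose Wm w := (S w == m)%:R * W w.
have := @fixed_batch_second_moment I n k m Wm (fun=> m%:R^-1) B a h H Ij.
rewrite (_ : (fun=> _) = cst m%:R^-1)// => /(_ _ _ (measurable_cst _) mB ma mh mH mean HB) key.
rewrite (eq_integral (fun w => (Wm w *
    norm2 (a w + m%:R^-1 *: \sum_(i < m) (H w (z n k i w) - h w)))%:E)); last first.
  by move=> w _; rewrite /Wm -EFinM mulrA; case: eqP => [->//|_]; rewrite !mul0r.
rewrite [leRHS](eq_integral (fun w => (Wm w *
    (norm2 (a w) + m%:R * (m%:R^-1 ^+ 2 * B w)))%:E)); last first.
  move=> w _; rewrite /Wm -EFinM; case: eqP => [->|_]; last by rewrite !mul0r.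
  rewrite !mul1r; congr (W w * (_ + _))%:E.
  have [->|m0] := posnP m; first by rewrite invr0 !mul0r.
  by rewrite expr2 !mulrA mulfV ?mul1r// pnatr_eq0 -lt0n.
apply: key => [|w]; last by rewrite mulr_ge0.
apply: measurable_funM => //.
by apply: (measurableT_comp (f := fun i => (i == m)%:R : R)).
Qed.

End BatchError.

(** * Bounds on means *)

Section MeanBounds.
Context {R : realType} {dO : measure_display} {Omega : measurableType dO}.
Context (P : probability Omega R).
Implicit Types (f g : Omega -> R) (a b : R).

(** Pathwise inequalities between nonnegative variables turn into inequalities
    between such bounds, without any integrability condition. *)
Definition mean_le f b : Prop :=
  [/\ measurable_fun setT f, forall w, 0 <= f w & (\int[P]_w (f w)%:E <= b%:E)%E].

Lemma mean_leD f g a b : mean_le f a -> mean_le g b ->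
  mean_le (fun w => f w + g w) (a + b).
Proof.
move=> [mf f0 fa] [mg g0 gb]; split; first exact: measurable_funD.
  by move=> w; rewrite addr_ge0.
under eq_integral do rewrite EFinD.
rewrite ge0_integralD ?EFinD ?leeD//; try exact/measurable_EFinP.
  by move=> w _; rewrite lee_fin.
by move=> w _; rewrite lee_fin.
Qed.

Lemma mean_leZ f a b : 0 <= a -> mean_le f b -> mean_le (fun w => a * f w) (a * b).
Proof.
move=> a0 [mf f0 fb]; split; first by apply: measurable_funM.
  by move=> w; rewrite mulr_ge0.
under eq_integral do rewrite EFinM.
rewrite ge0_integralZl_EFin//; first by rewrite EFinM lee_wpmul2l ?lee_fin.
  by move=> w _; rewrite lee_fin.
exact/measurable_EFinP.
Qed.

Lemma mean_le_le f g b : measurable_fun setT f -> (forall w, 0 <= f w <= g w) ->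
  mean_le g b -> mean_le f b.
Proof.
move=> mf fg [mg g0 gb]; split => // [w|]; first by case/andP: (fg w).
apply: le_trans gb; apply: ge0_le_integral => //; try exact/measurable_EFinP.
  by move=> w _; rewrite lee_fin; case/andP: (fg w).
by move=> w _; rewrite lee_fin; case/andP: (fg w).
Qed.

Lemma mean_leW f a b : a <= b -> mean_le f a -> mean_le f b.
Proof. by move=> ab [mf f0 fa]; split => //; rewrite (le_trans fa)// lee_fin. Qed.

Lemma mean_le_cst a : 0 <= a -> mean_le (fun=> a) a.
Proof.
move=> a0; split => //; rewrite integral_cst//.
by rewrite [X in (_ * X)%E]probability_setT mule1.
Qed.

Lemma mean_le_sum n (f : nat -> Omega -> R) (b : nat -> R) :
  (forall i, (i < n)%N -> mean_le (f i) (b i)) ->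
  mean_le (fun w => \sum_(i < n) f i w) (\sum_(i < n) b i).
Proof.
elim: n => [|n IH] fb.
  by under eq_fun do rewrite big_ord0; rewrite big_ord0; exact: mean_le_cst.
under eq_fun do rewrite big_ord_recr; rewrite big_ord_recr /=.
by apply: mean_leD; [apply: IH => i /ltnW; exact: fb|exact: fb].
Qed.

End MeanBounds.

(** * Batch sizes and coins *)

Section BatchSizes.
Context {R : realType}.
Implicit Types x : R.

Lemma nceil_ge x : x <= (nceil x)%:R.
Proof. by rewrite -nceil_le. Qed.

Lemma nceil_ub x : 0 <= x -> (nceil x)%:R <= x + 1.
Proof.
move=> x0; rewrite /nceil (max_idPr x0) natr_absz ger0_norm ?ceil_ge0; last first.
  by rewrite (lt_le_trans (ltrN10 _)).
have := ceilB1_lt x; rewrite intrB; lra.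
Qed.

Lemma batch_size_gt0 x : (0 < batch_size x)%N.
Proof. by rewrite /batch_size; case: nceil => [|m]; rewrite leq_max ?orbT. Qed.

Lemma batch_size_ge x : x <= (batch_size x)%:R.
Proof. by rewrite (le_trans (nceil_ge x))// ler_nat leq_maxr. Qed.

Lemma batch_size_ub x : 0 <= x -> (batch_size x)%:R <= x + 1.
Proof.
move=> x0; rewrite /batch_size; case: (nceil x) (nceil_ub x0) => [|m] h.
  by rewrite maxn0 lerDr.
by rewrite (maxn_idPr _).
Qed.

Lemma coin_prob_gt0 k : (0 < k)%N -> 0 < coin_prob k :> R.
Proof. by move=> k0; rewrite /coin_prob lt_min ltr01 divr_gt0 ?ltr0n. Qed.

Lemma coin_prob_le1 k : coin_prob k <= 1 :> R.
Proof. by rewrite /coin_prob ge_min lexx orbT. Qed.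

Lemma coin_prob_ge k : (0 < k)%N -> (k%:R)^-1 <= coin_prob k :> R.
Proof.
move=> k0; rewrite /coin_prob le_min invf_le1 ?ltr0n// ler1n k0 andbT.
rewrite -[leLHS]mul1r ler_wpM2r ?invr_ge0//; lra.
Qed.

End BatchSizes.

(** * The error of the estimates along a call *)

Section HalpernRun.
Context {R : realType} {d : nat} (dot : {dot 'rV[R]_d for idfun}).
Context {dO : measure_display} {Omega : measurableType dO} (P : probability Omega R).
Context {dZ : measure_display} {Z : measurableType dZ} (Pz : probability Z R).
Context (F : 'rV[R]_d -> 'rV[R]_d) (Fhat : 'rV[R]_d -> Z -> 'rV[R]_d).
Context (sigma L eta0 : R).
Context (z : nat -> nat -> nat -> {RV P >-> Z}) (c : nat -> nat -> {RV P >-> bool}).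
Hypothesis oracle : stochastic_oracle dot Pz F Fhat sigma L.
Hypothesis rnd : algorithm_randomness Pz z c.
Local Notation index := ((nat * nat * nat) + (nat * nat))%type.

Definition past n k : pred index := fun i =>
  let: (n', k') := match i with inl (n', k', _) => (n', k') | inr nk => nk end in
  (n' < n)%N || (n' == n) && (k' < k)%N.

Lemma past_sub n k l i : (k <= l)%N -> past n k i -> past n l i.
Proof. by case: i => [[[n' k'] j]|[n' k']]; rewrite /past; lia. Qed.

Lemma past_call n k i : past n k i -> past n.+1 0 i.
Proof. by case: i => [[[n' k'] j]|[n' k']]; rewrite /past; lia. Qed.

Context (n : nat) (eps : R) (U : Omega -> 'rV[R]_d).
Hypothesis mU : measurable_vec (U : known z c (past n 0) -> _).
Hypotheses (eps0 : 0 < eps) (L0 : 0 < L).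

Definition call_state k w := halpern dot Fhat sigma L eta0 (U w) eps
  (fun k i => z n k i w) (fun k => c n k w) k.

Lemma known_vec_sub (I J : pred index) (X : Omega -> 'rV[R]_d) : (forall i, I i -> J i) ->
  measurable_vec (X : known z c I -> _) -> measurable_vec (X : known z c J -> _).
Proof. by move=> IJ mX j; exact: (known_fun_sub IJ (mX j)). Qed.

Lemma known_vec (I : pred index) (X : Omega -> 'rV[R]_d) :
  measurable_vec (X : known z c I -> _) -> measurable_vec X.
Proof. by move=> mX j; exact: (known_fun (mX j)). Qed.

Let correction_size k w := nceil (8 * L ^+ 2 *
  dnorm dot (st_v (call_state k.+1 w) - st_v (call_state k w)) ^+ 2 /
  (coin_prob k.+1 ^+ 2 * eps ^+ 2)).

(* the next point is determined before its batch and coin are drawn *)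
Let measurable_next k :
  measurable_vec ((fun w => st_u (call_state k w)) : known z c (past n k.+1) -> _) ->
  measurable_vec ((fun w => st_v (call_state k w)) : known z c (past n k.+1) -> _) ->
  measurable_vec ((fun w => st_est (call_state k w)) : known z c (past n k.+1) -> _) ->
  measurable_vec ((fun w => st_v (call_state k.+1 w)) : known z c (past n k.+1) -> _)
  /\ measurable_fun setT (correction_size k : known z c (past n k.+1) -> _).
Proof.
move=> mu mv me.
have mv' : measurable_vec
    ((fun w => st_v (call_state k.+1 w)) : known z c (past n k.+1) -> _).
  have mU' := known_vec_sub (fun i => @past_sub n 0 k.+1 i isT) mU.
  apply: measurable_vecB.
    apply: measurable_vecD.
      by apply: (@measurable_vecZ _ _ _ _ (fun=> _)).
    by apply: (@measurable_vecZ _ _ _ _ (fun=> _)).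
  by apply: (@measurable_vecZ _ _ _ _ (fun=> _)).
split=> //; apply: measurable_nceil; apply: measurable_funM => //.
apply: measurable_funM => //; apply: measurable_funX; apply: measurable_dnorm.
exact: measurable_vecB.
Qed.

(** This is what makes the samples and the coin of iteration [k + 1] independent
    of the state on which they act. *)
Lemma measurable_call_state k :
  [/\ measurable_vec ((fun w => st_u (call_state k w)) : known z c (past n k.+1) -> _),
      measurable_vec ((fun w => st_v (call_state k w)) : known z c (past n k.+1) -> _),
      measurable_vec ((fun w => st_est (call_state k w)) : known z c (past n k.+1) -> _) &
      measurable_fun setT ((fun w => (st_queries (call_state k w))%:R) :
        known z c (past n k.+1) -> R)].
Proof.
elim: k => [|k [mu mv me mq]].
  have mU' := known_vec_sub (fun i => @past_sub n 0 1 i isT) mU.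
  split => //; apply: measurable_sample_mean => // i.
  apply: (measurable_oracle oracle) => //.
  by apply: known_sample; rewrite /past eqxx orbT.
have [mv' mS] := measurable_next mu mv me.
have IJ i : past n k.+1 i -> past n k.+2 i by exact: past_sub.
have mu2 := known_vec_sub IJ mu; have mv2 := known_vec_sub IJ mv.
have me2 := known_vec_sub IJ me; have mv'2 := known_vec_sub IJ mv'.
have mS2 := known_fun_sub IJ mS; have mq2 := known_fun_sub IJ mq.
have mU2 := known_vec_sub (fun i => @past_sub n 0 k.+2 i isT) mU.
have mc : measurable_fun setT (c n k.+1 : known z c (past n k.+2) -> bool).
  by apply: known_coin; rewrite /past eqxx ltnSn orbT.
have mz i : measurable_fun setT (z n k.+1 i : known z c (past n k.+2) -> Z).
  by apply: known_sample; rewrite /past eqxx ltnSn orbT.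
have me' : measurable_vec
    ((fun w => st_est (call_state k.+1 w)) : known z c (past n k.+2) -> _).
  apply: (measurable_vec_if mc).
    apply: measurable_sample_mean => // i.
    exact: (measurable_oracle oracle).
  apply: measurable_vecD => //; apply: measurable_sample_mean => // i.
  by apply: measurable_vecB; exact: (measurable_oracle oracle).
split => //.
  apply: measurable_vecB.
    apply: measurable_vecD.
      by apply: (@measurable_vecZ _ _ _ _ (fun=> _)).
    by apply: (@measurable_vecZ _ _ _ _ (fun=> _)).
  by apply: (@measurable_vecZ _ _ _ _ (fun=> _)).
rewrite /=; under eq_fun do rewrite natrD.
apply: measurable_funD => //; apply: (measurableT_comp (f := fun m => m%:R : R)) => //.
apply: measurable_fun_ifT => //.
by apply: (measurableT_comp (f := fun m => (2 * m)%N)).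
Qed.

Let est_kept k w : c n k.+1 w = false -> st_est (call_state k.+1 w) =
  st_est (call_state k w) + sample_mean (correction_size k w)
    (fun y => Fhat (st_v (call_state k.+1 w)) y - Fhat (st_v (call_state k w)) y)
    (fun i => z n k.+1 i w).
Proof. by rewrite /call_state /= => ->. Qed.

Definition estimation_error k w := st_est (call_state k w) - F (st_v (call_state k w)).

Lemma measurable_estimation_error k :
  measurable_vec (estimation_error k : known z c (past n k.+1) -> _).
Proof.
have [_ mv me _] := measurable_call_state k.
by apply: measurable_vecB => //; exact: (measurable_operator oracle).
Qed.

Let norm2 (u : 'rV[R]_d) := dot u u.

Let sample_meanB S (G : Z -> 'rV[R]_d) (x : nat -> Z) h : (0 < S)%N ->
  sample_mean S G x - h = S%:R^-1 *: \sum_(i < S) (G (x i) - h).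
Proof.
move=> S0; rewrite sumrB sumr_const card_ord scalerBr -[h *+ S]scaler_nat scalerA.
by rewrite mulVf ?scale1r// pnatr_eq0 -lt0n.
Qed.

(** The case [a = 0] of [batch_second_moment], for the centered oracle
    [Fhat V - F V]. *)
Lemma fresh_batch_error (I : pred index) m k (W : Omega -> R) (V : Omega -> 'rV[R]_d) S :
  (forall j, ~~ I (inl (m, k, j))) -> (0 < S)%N ->
  measurable_fun setT (W : known z c I -> R) -> (forall w, 0 <= W w) ->
  measurable_vec (V : known z c I -> _) ->
  (\int[P]_w (W w * norm2 (sample_mean S (Fhat (V w)) (fun i => z m k i w) - F (V w)))%:E
     <= \int[P]_w (W w * (sigma ^+ 2 / S%:R))%:E)%E.
Proof.
move=> Ij S0 mW W0 mV.
have := @batch_second_moment _ _ dot _ _ P _ _ Pz z c rnd I m k W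
  (fun=> sigma ^+ 2) (fun=> S) (fun=> 0) (fun=> 0) (fun w y => Fhat (V w) y - F (V w))
  Ij mW W0.
move=> /(_ (measurable_cst _) (measurable_cst _)).
move=> /(_ (@measurable_vec_cst _ _ _ _ _) (@measurable_vec_cst _ _ _ _ _)) H.
rewrite (eq_integral (fun w => (W w * norm2 (0 + S%:R^-1 *:
    \sum_(i < S) (Fhat (V w) (z m k i w) - F (V w) - 0)))%:E)); last first.
  move=> w _; congr (_ * norm2 _)%:E; rewrite add0r sample_meanB//.
  by under [in RHS]eq_bigr do rewrite subr0.
rewrite [leRHS](eq_integral (fun w => (W w * (norm2 0 + S%:R^-1 * sigma ^+ 2))%:E)); last first.
  by move=> w _; rewrite /norm2 dot0l add0r mulrC [_ / _]mulrC mulrC.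
apply: H => [|w j|w].
- have mV1 : measurable_vec (fun x : known z c I * Z => V x.1).
    by move=> j; exact: (measurableT_comp (mV j) measurable_fst).
  apply: measurable_vecB; last exact: (measurable_operator oracle).
  exact: (measurable_oracle oracle).
- have -> : (0 : 'rV[R]_d) 0 j = (F (V w) - F (V w)) 0 j by rewrite subrr.
  have mw : measurable_vec (fun y : Z => Fhat (V w) y).
    by apply: (measurable_oracle oracle (X := cst (V w)) (Y := id)) => //; exact: measurable_vec_cst.
  apply: integral_vecB (oracle_mean oracle _ _) _ => //.
  by rewrite integral_cst// [X in (_ * X)%E]probability_setT mule1.
- exact: (oracle_second_moment oracle (V w)).
Qed.

(** With probability [p] the old error is replaced by that of a fresh batch, at
    most [p eps ^ 2 / 8].  Otherwise it is kept and increased by at most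
    [p ^ 2 eps ^ 2 / 8], because the size of the correction batch is adapted to the
    length of the step and the oracle is Lipschitz in mean square. *)
Lemma estimation_error_step k b (p := coin_prob k.+1 : R) : 0 <= b ->
  mean_le P (fun w => norm2 (estimation_error k w)) b ->
  mean_le P (fun w => norm2 (estimation_error k.+1 w))
    (p * (p * eps ^+ 2 / 8) + (1 - p) * (b + p ^+ 2 * eps ^+ 2 / 8)).
Proof.
move=> b0 [merr err0 errb].
have p0 : 0 < p by exact: coin_prob_gt0.
have p1 : p <= 1 by exact: coin_prob_le1.
have [mu mv me _] := measurable_call_state k.
have [mv' mS] := measurable_next mu mv me.
have mek := @measurable_estimation_error k.
have merr' : measurable_fun setT (fun w => norm2 (estimation_error k.+1 w)).
  by apply: measurable_dot; exact: (known_vec (@measurable_estimation_error k.+1)).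
split => // [w|]; first exact: dot_ge0.
(* what is known once the coin is flipped and before the batch is drawn *)
pose I i := past n k.+1 i || (i == inr (n, k.+1)).
have IJ i : past n k.+1 i -> I i by rewrite /I => ->.
have Ij j : ~~ I (inl (n, k.+1, j)) by rewrite /I /past eqxx ltnn ltnn.
have Jc : ~~ past n k.+1 (inr (n, k.+1)) by rewrite /past eqxx !ltnn.
have mc : measurable_fun setT (c n k.+1 : known z c I -> bool).
  by apply: known_coin; rewrite /I eqxx orbT.
pose W (b : bool) w : R := (c n k.+1 w == b)%:R.
have mW b' : measurable_fun setT (W b' : known z c I -> R).
  by apply: (measurableT_comp (f := fun y : bool => (y == b')%:R : R) _ mc).
have W0 b' w : 0 <= W b' w by rewrite ler0n.
have mWT b' : measurable_fun setT (W b') by exact: (known_fun (mW b')).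
rewrite (eq_integral (fun w => ((W true w * norm2 (estimation_error k.+1 w))%:E +
    (W false w * norm2 (estimation_error k.+1 w))%:E)%E)); last first.
  move=> w _; rewrite /W -EFinD; case: (c n k.+1 w).
    by rewrite eqxx mul1r mul0r addr0.
  by rewrite eqxx mul1r mul0r add0r.
have mWn b' : measurable_fun setT
    (fun w => (W b' w * norm2 (estimation_error k.+1 w))%:E).
  by apply/measurable_EFinP; exact: measurable_funM.
have Wn0 b' w : (0 <= (W b' w * norm2 (estimation_error k.+1 w))%:E)%E.
  by rewrite lee_fin mulr_ge0// dot_ge0.
rewrite ge0_integralD// EFinD leeD//.
  pose S := batch_size (8 * sigma ^+ 2 / (p * eps ^+ 2)).
  rewrite (eq_integral (fun w => (W true w * norm2 (sample_mean S
      (Fhat (st_v (call_state k.+1 w))) (fun i => z n k.+1 i w) -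
      F (st_v (call_state k.+1 w))))%:E)); last first.
    by move=> w _; rewrite /W /estimation_error /=; case: (c n k.+1 w) => //=; rewrite !mul0r.
  apply: le_trans (fresh_batch_error Ij (batch_size_gt0 _) (mW true) (W0 true)
    (known_vec_sub IJ mv')) _.
  apply: (@le_trans _ _ (\int[P]_w ((c n k.+1 w == true)%:R%:E *
      (p * eps ^+ 2 / 8)%:E))%E).
    apply: ge0_le_integral => //.
    - by move=> w _; rewrite lee_fin mulr_ge0// divr_ge0// sqr_ge0.
    - by apply/measurable_EFinP; apply: measurable_funM.
    - by apply: emeasurable_funM => //; exact/measurable_EFinP/(mWT true).
    move=> w _; rewrite -EFinM lee_fin ler_wpM2l//.
    rewrite ler_pdivrMr ?ltr0n ?batch_size_gt0//.
    have := batch_size_ge (8 * sigma ^+ 2 / (p * eps ^+ 2)); rewrite -/S.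
    rewrite ler_pdivrMr; last by rewrite mulr_gt0// exprn_gt0.
    lra.
  rewrite (ge0_integral_coin rnd (I := past n k.+1) (h := cst (p * eps ^+ 2 / 8)%:E))//; last first.
    by move=> w; rewrite lee_fin divr_ge0// mulr_ge0// ?sqr_ge0// ltW.
  by rewrite integral_cst// [X in (_ * (_ * X))%E]probability_setT mule1 EFinM.
pose v' w := st_v (call_state k.+1 w); pose v w := st_v (call_state k w).
rewrite (eq_integral (fun w => (W false w * norm2 (estimation_error k w +
    (correction_size k w)%:R^-1 *: \sum_(i < correction_size k w)
      (Fhat (v' w) (z n k.+1 i w) - Fhat (v w) (z n k.+1 i w) - (F (v' w) - F (v w)))))%:E));
    last first.
  move=> w _; rewrite /W; case cw: (c n k.+1 w); first by rewrite !mul0r.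
  rewrite !mul1r; congr (norm2 _)%:E.
  rewrite /estimation_error est_kept// -/(v' w) -/(v w).
  (* the correction batch is empty only if the point has not moved *)
  have [S0|S0] := posnP (correction_size k w).
    have vv : v' w = v w.
      apply/eqP; rewrite -subr_eq0; apply/negPn/negP => /(dot_gt0 dot) vv0.
      have : (correction_size k w <= 0)%N by rewrite S0.
      rewrite nceil_le dnormE leNgt -/(v' w) -/(v w) => /negP; apply.
      by rewrite divr_gt0 ?mulr_gt0 ?exprn_gt0.
    by rewrite S0 /sample_mean !big_ord0 !scaler0 !addr0 vv.
  rewrite -(@sample_meanB _ (fun y => Fhat (v' w) y - Fhat (v w) y)
    (fun i => z n k.+1 i w))//.
  move: (sample_mean _ _ _) (st_est _) (F (v' w)) (F (v w)) => m e f' f.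
  by rewrite opprB [RHS]addrCA (addrA (e - f)) subrK [LHS]addrAC addrC.
have mB : measurable_fun setT ((fun w => L ^+ 2 * norm2 (v' w - v w)) :
    known z c (past n k.+1) -> R).
  by apply: measurable_funM => //; apply: measurable_dot; exact: measurable_vecB.
have mF w : measurable_vec (fun y : Z => Fhat w y).
  by apply: (measurable_oracle oracle (X := cst w) (Y := id)) => //; exact: measurable_vec_cst.
have := @batch_second_moment _ _ dot _ _ P _ _ Pz z c rnd I n k.+1 (W false)
  (fun w => L ^+ 2 * norm2 (v' w - v w)) (correction_size k) (estimation_error k)
  (fun w => F (v' w) - F (v w)) (fun w y => Fhat (v' w) y - Fhat (v w) y)
  Ij (mW false) (W0 false) (known_fun_sub IJ mS) (known_fun_sub IJ mB)
  (known_vec_sub IJ mek).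
have mvI := known_vec_sub IJ mv; have mv'I := known_vec_sub IJ mv'.
move=> H; apply: le_trans (H _ _ _ _) _.
- by apply: measurable_vecB; exact: (measurable_operator oracle).
- apply: measurable_vecB; apply: (measurable_oracle oracle) => //.
    by move=> j; exact: (measurableT_comp (mv'I j) measurable_fst).
  by move=> j; exact: (measurableT_comp (mvI j) measurable_fst).
- by move=> w j; apply: integral_vecB (oracle_mean oracle _ _) (oracle_mean oracle _ _).
- by move=> w; exact: (oracle_increment_second_moment oracle).
have b8 : 0 <= p ^+ 2 * eps ^+ 2 / 8 by rewrite divr_ge0// mulr_ge0// sqr_ge0.
pose h w : \bar R := (norm2 (estimation_error k w) + p ^+ 2 * eps ^+ 2 / 8)%:E.
have mh : measurable_fun setT (h : known z c (past n k.+1) -> \bar R).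
  by apply/measurable_EFinP; apply: measurable_funD => //; exact: measurable_dot.
have h0 w : (0 <= h w)%E by rewrite lee_fin addr_ge0// dot_ge0.
apply: (@le_trans _ _ (\int[P]_w ((c n k.+1 w == false)%:R%:E * h w))%E).
  have Sinv0 w : 0 <= (correction_size k w)%:R^-1 * (L ^+ 2 * norm2 (v' w - v w)).
    by rewrite mulr_ge0 ?invr_ge0// mulr_ge0 ?dot_ge0 ?sqr_ge0.
  apply: ge0_le_integral => //.
  - by move=> w _; rewrite lee_fin mulr_ge0// addr_ge0// dot_ge0.
  - apply/measurable_EFinP; apply: measurable_funM => //; apply: measurable_funD => //.
    apply: measurable_funM; last exact: (known_fun mB).
    apply: (measurableT_comp (f := fun m => m%:R^-1 : R)) => //; exact: (known_fun mS).
  - by apply: emeasurable_funM; [exact/measurable_EFinP/(mWT false)|exact: known_fun mh].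
  move=> w _; rewrite -EFinM lee_fin ler_wpM2l// lerD2l.
  have [S0|S0] := posnP (correction_size k w); first by rewrite S0 invr0 mul0r.
  rewrite mulrC ler_pdivrMr ?ltr0n//.
  have := nceil_ge (8 * L ^+ 2 * dnorm dot (v' w - v w) ^+ 2 / (p ^+ 2 * eps ^+ 2)).
  rewrite -/(correction_size k w) dnormE ler_pdivrMr; last by rewrite mulr_gt0// exprn_gt0.
  rewrite /norm2; lra.
rewrite (ge0_integral_coin rnd (I := past n k.+1))// [leRHS]EFinM lee_wpmul2l ?lee_fin ?subr_ge0//.
rewrite /h; under eq_integral do rewrite EFinD.
rewrite ge0_integralD//=; last 2 first.
- by move=> w _; rewrite lee_fin dot_ge0.
- exact/measurable_EFinP.
by rewrite integral_cst// [X in (_ + _ * X)%E]probability_setT mule1 EFinD leeD2r.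
Qed.

Lemma estimation_error_init :
  mean_le P (fun w => norm2 (estimation_error 0 w)) (eps ^+ 2).
Proof.
split => [|w|]; [|exact: dot_ge0|].
  by apply: measurable_dot; exact: (known_vec (@measurable_estimation_error 0)).
pose S := batch_size (8 * sigma ^+ 2 / eps ^+ 2).
have I0 j : ~~ past n 0 (inl (n, 0%N, j)) by rewrite /past eqxx !ltnn.
have := @fresh_batch_error (past n 0) n 0 (fun=> 1) U S I0 (batch_size_gt0 _).
move=> /(_ (measurable_cst _) (fun=> ler01) mU).
under eq_integral do rewrite mul1r.
under [leRHS]eq_integral do rewrite mul1r.
rewrite integral_cst// [X in (_ <= _ * X)%E]probability_setT mule1.
move=> /le_trans; apply; rewrite lee_fin ler_pdivrMr ?ltr0n ?batch_size_gt0//.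
have := batch_size_ge (8 * sigma ^+ 2 / eps ^+ 2); rewrite -/S.
rewrite ler_pdivrMr ?exprn_gt0//.
by have := sqr_ge0 sigma; lra.
Qed.

(** The recursion of [estimation_error_step] with [p = 2 / k] preserves the decay
    [1 / k]: the factor [1 - p] lowers [1 / (k - 1)] by about [2 / k ^ 2], of which
    [1 / k ^ 2] pays for the two new terms and the rest is the required decrease. *)
Lemma estimation_error_bound k :
  mean_le P (fun w => norm2 (estimation_error k w)) (eps ^+ 2 / (maxn 1 k)%:R).
Proof.
elim: k => [|k IH]; first by rewrite divr1; exact: estimation_error_init.
have e0 : 0 < eps ^+ 2 by rewrite exprn_gt0.
have b0 : 0 <= eps ^+ 2 / (maxn 1 k)%:R by rewrite divr_ge0 ?sqr_ge0.
apply: mean_leW (estimation_error_step b0 IH).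
have -> : maxn 1 k.+1 = k.+1 by exact/maxn_idPr.
rewrite /coin_prob.
have [k2|k2] := leqP k 1.
  rewrite (min_idPr _); last first.
    by rewrite ler_pdivlMr ?ltr0n// mul1r ler_nat; lia.
  rewrite subrr mul0r addr0 !mul1r ler_pM2l// lef_pV2 ?posrE ?ltr0n//.
  by rewrite ler_nat; lia.
rewrite (min_idPl _); last by rewrite ler_pdivrMr ?ltr0n// mul1r ler_nat; lia.
have k0 : 2 <= k%:R :> R by rewrite ler_nat.
rewrite -[k.+1%:R]natr1; set x := k%:R in k0 *; set e := eps ^+ 2 in e0 *.
rewrite -subr_ge0.
rewrite [X in 0 <= X](_ : _ = e / (2 * x * (x + 1) ^+ 3) *
    (2 * x * (x + 1) ^+ 2 - x * (x + 1) - (x - 1) * (2 * (x + 1) ^+ 2 + x))).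
2: by field; lra.
apply: mulr_ge0; last by nra.
by rewrite divr_ge0 ?(ltW e0)// mulr_ge0 ?exprn_ge0//; lra.
Qed.

End HalpernRun.

(** * Step sizes *)

Section Stepsizes.
Context {R : realType} (M eta0 : R).
Hypotheses (M0 : 0 < M) (eta0_gt0 : 0 < eta0) (Meta0 : M * eta0 ^+ 2 <= 3^-1).
Local Notation eta := (stepsize M eta0).
Local Notation q0 := (M * eta0 ^+ 2).

Let q0_gt0 : 0 < q0. Proof. by rewrite mulr_gt0// exprn_gt0. Qed.

Lemma eta_lowE : eta_low M eta0 = eta0 * (1 - q0 / (1 - q0)).
Proof. by have h := Meta0; rewrite /eta_low; field; lra. Qed.

Lemma eta_low_ge : eta0 / 2 <= eta_low M eta0.
Proof.
have h := Meta0; rewrite eta_lowE ler_pM2l//.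
have : q0 / (1 - q0) <= 2^-1 by rewrite ler_pdivrMr; lra.
lra.
Qed.

Lemma eta_low_gt0 : 0 < eta_low M eta0.
Proof. by rewrite (lt_le_trans _ eta_low_ge)// divr_gt0. Qed.

Lemma eta_low_le : eta_low M eta0 <= eta0.
Proof.
have h := Meta0; have h0 := q0_gt0; rewrite eta_lowE -[leRHS]mulr1 ler_pM2l//.
have : 0 <= q0 / (1 - q0) by rewrite divr_ge0//; lra.
lra.
Qed.

Lemma stepsizeS k : M * eta k ^+ 2 <= 3^-1 ->
  eta k.+1 = eta k - eta k * (M * eta k ^+ 2) /
    ((1 - M * eta k ^+ 2) * (k%:R + 1) * (k%:R + 3)).
Proof.
move=> Me; rewrite /=; set e := eta k in Me *.
have k0 : 0 <= k%:R :> R by [].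
have -> : k.+2%:R = k%:R + 2 :> R by rewrite -addn2 natrD.
have -> : k.+3%:R = k%:R + 3 :> R by rewrite -addn3 natrD.
have -> : k.+1%:R = k%:R + 1 :> R by rewrite -natr1.
by field; lra.
Qed.

(** The losses of the step size telescope against [1 / (k + 1)]. *)
Lemma stepsize_bounds k :
  eta0 * (1 - q0 / (1 - q0) * (1 - (k%:R + 1)^-1)) <= eta k <= eta0.
Proof.
have h := Meta0; have q00 := q0_gt0.
elim: k => [|k /andP[lo hi]]; first by rewrite add0r invr1 subrr mulr0 subr0 mulr1 lexx.
have k0 : 0 <= k%:R :> R by [].
have kinv0 : 0 <= (k%:R + 1)^-1 :> R by rewrite invr_ge0; lra.
have kinv1 : (k%:R + 1)^-1 <= 1 :> R by rewrite invf_le1; lra.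
have e0 : 0 < eta k.
  apply: lt_le_trans lo; rewrite mulr_gt0// subr_gt0.
  have : q0 / (1 - q0) <= 2^-1 by rewrite ler_pdivrMr; lra.
  have : 0 <= q0 / (1 - q0) by rewrite divr_ge0//; lra.
  nra.
have qle : M * eta k ^+ 2 <= q0 by rewrite ler_pM2l// ler_pXn2r// nnegrE ltW.
have q1 : M * eta k ^+ 2 <= 3^-1 by exact: le_trans qle Meta0.
have qk : 0 < M * eta k ^+ 2 by rewrite mulr_gt0// exprn_gt0.
rewrite (stepsizeS q1) -natr1 -addrA.
set loss := (X in eta k - X).
have loss0 : 0 <= loss.
  by rewrite /loss divr_ge0// ?mulr_ge0 ?ltW//; lra.
have lossle : loss <= eta0 * (q0 / (1 - q0)) * ((k%:R + 1)^-1 - (k%:R + 2)^-1).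
  have -> : (k%:R + 1)^-1 - (k%:R + 2)^-1 = ((k%:R + 1) * (k%:R + 2))^-1 :> R.
    by field; lra.
  have -> : loss = eta k * (M * eta k ^+ 2 / (1 - M * eta k ^+ 2)) *
      ((k%:R + 1) * (k%:R + 3))^-1 by rewrite /loss; field; lra.
  apply: ler_pM.
  - by rewrite mulr_ge0 ?ltW// divr_gt0//; lra.
  - by rewrite invr_ge0 mulr_ge0//; lra.
  - apply: ler_pM => //; [by rewrite ltW|by rewrite divr_ge0 ?ltW//; lra|].
    rewrite ler_pdivrMr; last lra.
    by rewrite mulrAC ler_pdivlMr; lra.
  - by rewrite lef_pV2 ?posrE ?mulr_gt0//; try lra; rewrite ler_pM2l; lra.
apply/andP; split; last by lra.
have -> : 1 + 1 = 2 :> R by lra.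
nra.
Qed.

Lemma stepsize_ge k : eta_low M eta0 <= eta k.
Proof.
have h := Meta0; have /andP[+ _] := stepsize_bounds k; apply: le_trans.
rewrite eta_lowE ler_pM2l// lerD2l lerN2 -[leRHS]mulr1.
apply: ler_wpM2l; first by rewrite divr_ge0 ?ltW//; lra.
by rewrite gerBl invr_ge0; have : 0 <= k%:R :> R by []; lra.
Qed.

Lemma stepsize_le k : eta k <= eta0.
Proof. by have /andP[] := stepsize_bounds k. Qed.

Lemma stepsize_gt0 k : 0 < eta k.
Proof. exact: lt_le_trans eta_low_gt0 (stepsize_ge k). Qed.

Lemma stepsize_small k : M * eta k ^+ 2 <= 3^-1.
Proof.
apply: le_trans Meta0; rewrite ler_pM2l//.
by rewrite ler_pXn2r ?stepsize_le// nnegrE ltW// stepsize_gt0.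
Qed.

Lemma stepsize_nonincreasing k : eta k.+1 <= eta k.
Proof.
rewrite (stepsizeS (stepsize_small k)) gerBl.
have h := stepsize_small k; have h0 := stepsize_gt0 k.
have k0 : 0 <= k%:R :> R by [].
apply: divr_ge0; first by rewrite mulr_ge0 ?ltW// mulr_gt0 ?exprn_gt0.
by rewrite !mulr_ge0//; lra.
Qed.

End Stepsizes.

(** * The potential *)

Section Potential.
Context {R : realType}.

(* the scalar part of [potential_step]: [x], [x'], [g] stand for the squares of
   the norms of [X], [X'], [G], two letters for an inner product, and [s1], [s0],
   [s], [n] for [|X - G|^2], [|X - H|^2], [|X' - G|^2], [|G - Y|^2] *)
Let potential_scalar (M L k e e' x x' g xg x'g xd x'd x'd' s1 s0 s n gh : R) :
  0 < L -> M = 9 * L ^+ 2 -> 1 <= k -> 0 < e -> M * e ^+ 2 <= 3^-1 ->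
  0 <= e' <= e ->
  e' = e - e * (M * e ^+ 2) / ((1 - M * e ^+ 2) * k * (k + 2)) ->
  x'd' = k / (k + 1) * x'd - e * x'g ->
  0 <= k / (k + 1) * x'd - e * x'g - x'd - (k / (k + 1) * xd - e * xg - xd) ->
  (forall a b, 0 <= a ^+ 2 * x' - 2 * a * b * x'g + b ^+ 2 * g) ->
  s = x' - 2 * x'g + g -> s1 = x - 2 * xg + g ->
  s <= 2 * (L ^+ 2 * e ^+ 2 * gh) + 2 * n -> gh <= 2 * s1 + 2 * s0 ->
  0 <= s1 -> 0 <= s0 -> 0 <= n ->
  e' * ((k + 1) * (k + 2)) / 2 * (x' + s) + (k + 1) * x'd'
    <= e * (k * (k + 1)) / 2 * (x + s0) + k * xd
       + e * (k + 1) * (k / (M * e ^+ 2) + (k + 2)) * n.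
Proof.
move=> L0 ML k1 e0 q3 /andP[e'0 e'e] e'E x'd'E mono sq sE s1E lip ghle s10 s00 n0.
have M0 : 0 < M by rewrite ML mulr_gt0// exprn_gt0.
have q0 : 0 < M * e ^+ 2 by rewrite mulr_gt0// exprn_gt0.
have le2 : L ^+ 2 * e ^+ 2 = M * e ^+ 2 / 9 by rewrite ML; field.
move: (M * e ^+ 2) q0 q3 e'E le2 => q q0 q3 e'E le2 {ML M0}.
have [t tE] : exists t, t = k / q by exists (k / q).
have [a aE] : exists a, a = e' / e * (k + 2) by exists (e' / e * (k + 2)).
have {}mono : (k + 1) * x'd' <=
    k * xd - e * (k + 1) ^+ 2 * x'g + e * k * (k + 1) * xg.
  have k10 : k + 1 != 0 by lra.
  have h : 0 <= k * (k + 1) *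
      (k / (k + 1) * x'd - e * x'g - x'd - (k / (k + 1) * xd - e * xg - xd)).
    by rewrite mulr_ge0// mulr_ge0; lra.
  have E1 : k * (k + 1) *
      (k / (k + 1) * x'd - e * x'g - x'd - (k / (k + 1) * xd - e * xg - xd)) =
    - k * x'd + k * xd - e * k * (k + 1) * x'g + e * k * (k + 1) * xg by field.
  have E2 : (k + 1) * x'd' = k * x'd - e * (k + 1) * x'g by rewrite x'd'E; field.
  by rewrite E1 in h; rewrite E2; lra.
have t3 : 3 * k <= t.
  rewrite tE ler_pdivlMr//.
  have : k * (3 * q) <= k * 1 by rewrite ler_wpM2l//; lra.
  lra.
have a0 : 0 <= a by rewrite aE mulr_ge0//; [rewrite divr_ge0// ltW|lra].
have ak : a <= k + 2.
  rewrite aE -[leRHS]mul1r ler_wpM2r//; first lra.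
  by rewrite ler_pdivrMr ?mul1r.
(* the recursion for the step sizes makes the discriminant of the quadratic form
   in [X'] and [G] vanish *)
have tE2 : (t - (k + 1)) ^+ 2 = (t - a) * (t - k).
  by rewrite tE aE e'E; field; lra.
have square : a * x' - 2 * (k + 1) * x'g + k * g <= t * s.
  have tk : 0 < t - k by lra.
  have h : 0 <= (t - k) * ((t - a) * x' - 2 * (t - (k + 1)) * x'g + (t - k) * g).
    by apply: le_trans (sq (t - (k + 1)) (t - k)) _; rewrite tE2; lra.
  by move: h; rewrite pmulr_rge0// sE; lra.
have gh' : L ^+ 2 * e ^+ 2 * gh <= q / 9 * (2 * s1 + 2 * s0).
  by rewrite le2 ler_wpM2l// divr_ge0// ltW.
have tS : (t + a) * s <= k * (s1 + s0) + 2 * (t + (k + 2)) * n.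
  have h1 : (t + a) * s <= (t + a) * (4 * (q / 9) * (s1 + s0) + 2 * n).
    by rewrite ler_wpM2l//; lra.
  have h2 : (t + a) * (4 * (q / 9)) <= k.
    have : t * q = k by rewrite tE mulfVK// gt_eqF.
    have : a * q <= (k + 2) * 3^-1 by apply: ler_pM => //; rewrite ltW.
    lra.
  have h3 : (t + a) * (4 * (q / 9)) * (s1 + s0) <= k * (s1 + s0).
    by rewrite ler_wpM2r// addr_ge0.
  have : a * n <= (k + 2) * n by rewrite ler_wpM2r.
  lra.
have key : a * (x' + s) - 2 * (k + 1) * x'g + 2 * k * xg <=
    k * (x + s0) + 2 * (t + (k + 2)) * n by rewrite s1E in tS; lra.
have {}key : e * (k + 1) / 2 * (a * (x' + s) - 2 * (k + 1) * x'g + 2 * k * xg) <=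
    e * (k + 1) / 2 * (k * (x + s0) + 2 * (t + (k + 2)) * n).
  by rewrite ler_wpM2l// divr_ge0// mulr_ge0 ?(ltW e0)// addr_ge0// (le_trans ler01 k1).
have E : e' * ((k + 1) * (k + 2)) / 2 * (x' + s) = e * (k + 1) / 2 * (a * (x' + s)).
  by rewrite aE; field; lra.
rewrite E -tE; lra.
Qed.

Context {d : nat} (dot : {dot 'rV[R]_d for idfun}).
Local Notation norm2 u := (dot u u).

(** One iteration, with [k] the number of the iteration, [e] its step size and
    [e'] the next one.  [X] and [X'] are the operator at the old and the new
    iterate, [Y] at the extrapolated point, [H] and [G] the old and the new
    estimate, and [D], [D'] the displacements of the iterates from the anchor.
    Monotonicity makes the inner products telescope.  What remains is a quadratic
    form in [X'] and [G] which, by the recursion for the step sizes, is at most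
    [t |X' - G|^2] with [t = k / (M e^2)]: the difference is a perfect square.
    Since [X' - Y] is controlled by [G - H] through the Lipschitz condition, the
    terms [|X - G|^2] and [|X - H|^2] of the potential absorb it. *)
Lemma potential_step (M L k e e' : R) (X X' Y H G D D' : 'rV[R]_d) :
  0 < L -> M = 9 * L ^+ 2 -> 1 <= k -> 0 < e -> M * e ^+ 2 <= 3^-1 ->
  0 <= e' <= e ->
  e' = e - e * (M * e ^+ 2) / ((1 - M * e ^+ 2) * k * (k + 2)) ->
  D' = (k / (k + 1)) *: D - e *: G ->
  0 <= dot (X' - X) (D' - D) ->
  norm2 (X' - Y) <= L ^+ 2 * e ^+ 2 * norm2 (G - H) ->
  e' * ((k + 1) * (k + 2)) / 2 * (norm2 X' + norm2 (X' - G)) + (k + 1) * dot X' D'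
    <= e * (k * (k + 1)) / 2 * (norm2 X + norm2 (X - H)) + k * dot X D
       + e * (k + 1) * (k / (M * e ^+ 2) + (k + 2)) * norm2 (G - Y).
Proof.
move=> L0 ML k1 e0 q3 e'e e'E D'E mono lip.
apply: (@potential_scalar M L k e e' (norm2 X) (norm2 X') (norm2 G) (dot X G)
  (dot X' G) (dot X D) (dot X' D) (dot X' D') (norm2 (X - G)) (norm2 (X - H))
  (norm2 (X' - G)) (norm2 (G - Y)) (norm2 (G - H))) => //; rewrite ?dot_ge0//.
- by rewrite D'E !dotE.
- apply: le_trans mono _; rewrite D'E !dotE le_eqVlt; apply/orP; left; apply/eqP.
  by ring.
- move=> a b; apply: le_trans (dot_ge0 dot (a *: X' - b *: G)) _.
  by rewrite !dotE (dotC dot G X') le_eqVlt; apply/orP; left; apply/eqP; ring.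
- by rewrite !dotE (dotC dot G X'); ring.
- by rewrite !dotE (dotC dot G X); ring.
- have := dot_sum2 dot (X' - Y) (Y - G); rewrite addrA subrK.
  have -> : norm2 (Y - G) = norm2 (G - Y) by rewrite -opprB dotNl dotNr opprK.
  by move=> /le_trans; apply; rewrite lerD2r ler_pM2l.
- have := dot_sum2 dot (G - X) (X - H); rewrite addrA subrK.
  by have -> : norm2 (G - X) = norm2 (X - G) by rewrite -opprB dotNl dotNr opprK.
Qed.

End Potential.

(** * Trajectories driven by given estimates *)

(** The deterministic part of the analysis: the iterates [u] and extrapolated
    points [v] are driven by arbitrary estimates [G k] of the operator at [v k],
    and every bound is in terms of the errors [G k - F (v k)]. *)
Section Trajectory.
Context {R : realType} {d : nat} (dot : {dot 'rV[R]_d for idfun}).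
Context (F : 'rV[R]_d -> 'rV[R]_d) (L eta0 : R) (u0 ustar : 'rV[R]_d).
Context (u v G : nat -> 'rV[R]_d).
Hypotheses (L0 : 0 < L) (eta0_gt0 : 0 < eta0).
Hypothesis small : Defs.coefM L * eta0 ^+ 2 <= 3^-1.
Hypothesis mono : monotone_operator dot F.
Hypothesis lip : lipschitz_operator dot L F.
Hypothesis Fstar : F ustar = 0.
Local Notation norm2 x := (dot x x).
Local Notation M := (Defs.coefM L).
Local Notation eta := (stepsize M eta0).
Local Notation el := (eta_low M eta0).
Hypothesis u_0 : u 0%N = u0.
Hypothesis v_0 : v 0%N = u0.
Hypothesis uS : forall k, u k.+1 =
  k.+2%:R^-1 *: u0 + (k.+1%:R / k.+2%:R) *: u k - eta k *: G k.+1.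
Hypothesis vS : forall k, v k.+1 =
  k.+2%:R^-1 *: u0 + (k.+1%:R / k.+2%:R) *: u k - eta k *: G k.

#[local] Opaque eta_low stepsize.

Let M0 : 0 < M. Proof. by rewrite mulr_gt0// exprn_gt0. Qed.
Let el0 : 0 < el. Proof. exact: eta_low_gt0. Qed.
Let eta_gt0 k : 0 < eta k. Proof. exact: stepsize_gt0. Qed.
Let eta_le k : eta k <= eta0. Proof. exact: stepsize_le. Qed.

Lemma lipschitz_norm2 x y : norm2 (F x - F y) <= L ^+ 2 * norm2 (x - y).
Proof.
have := lip x y; rewrite -!dnormE -exprMn => h.
by rewrite ler_pXn2r// nnegrE ?dnorm_ge0// mulr_ge0 ?dnorm_ge0 ?ltW.
Qed.

Let displacement k : u k.+1 - u0 =
  (k.+1%:R / (k.+1%:R + 1)) *: (u k - u0) - eta k *: G k.+1.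
Proof.
rewrite uS [LHS]addrAC; congr (_ - _).
have -> : k.+2%:R = k.+1%:R + 1 :> R by rewrite natr1.
have k0 : 0 < k.+1%:R :> R by rewrite ltr0n.
rewrite scalerBr addrAC addrC; congr (_ + _).
rewrite -{2}[u0]scale1r -scalerBl -scaleNr; congr (_ *: _).
by field; lra.
Qed.

Let extrapolation_gap k : u k.+1 - v k.+1 = - (eta k *: (G k.+1 - G k)).
Proof.
by rewrite uS vS [X in _ + X]opprB addrC addrA subrK scalerBr opprB.
Qed.

Let noise := (M * el)^-1 + 3 * eta0.

(** Summing [potential_step] along the run.  The step sizes stay between [el] and
    [eta0], so the coefficient of the [j]-th error there is at most
    [noise (j + 1) (j + 2)]. *)
Lemma halpern_potential k :
  eta k * ((k%:R + 1) * (k%:R + 2)) / 2 * (norm2 (F (u k)) + norm2 (F (u k) - G k))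
    + (k%:R + 1) * dot (F (u k)) (u k - u0)
  <= eta0 * (L ^+ 2 * norm2 (u0 - ustar) + norm2 (G 0 - F (v 0)))
     + noise * \sum_(j < k) (j%:R + 1) * (j%:R + 2) * norm2 (G j.+1 - F (v j.+1)).
Proof.
elim: k => [|k IH].
  rewrite big_ord0 mulr0 addr0 !add0r !mul1r /= mulfK// u_0 v_0.
  rewrite subrr [dot _ 0]dotC dot0l addr0 ler_pM2l//.
  apply: lerD; first by have := lipschitz_norm2 u0 ustar; rewrite Fstar subr0.
  by rewrite -opprB dotNl dotNr opprK.
have k1 : 1 <= k.+1%:R :> R by rewrite ler1n.
have ek0 := eta_gt0 k; have eku := eta_le k.
have ekl := stepsize_ge M0 eta0_gt0 small k.
have ek3 := stepsize_small M0 eta0_gt0 small k.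
have e'e : 0 <= eta k.+1 <= eta k.
  by rewrite ltW ?eta_gt0// stepsize_nonincreasing.
have e'E : eta k.+1 = eta k - eta k * (M * eta k ^+ 2) /
    ((1 - M * eta k ^+ 2) * k.+1%:R * (k.+1%:R + 2)).
  rewrite (stepsizeS ek3) -[k.+1%:R]natr1; congr (_ - _ / (_ * _)).
  by rewrite -addrA; congr (_ + _); lra.
have monoS : 0 <= dot (F (u k.+1) - F (u k)) (u k.+1 - u0 - (u k - u0)).
  by rewrite opprB addrA subrK; exact: mono.
have lipS : norm2 (F (u k.+1) - F (v k.+1)) <=
    L ^+ 2 * eta k ^+ 2 * norm2 (G k.+1 - G k).
  apply: le_trans (lipschitz_norm2 _ _) _.
  by rewrite extrapolation_gap dotNl dotNr opprK dotZl dotZr !mulrA.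
have := potential_step L0 erefl k1 ek0 ek3 e'e e'E (displacement k) monoS lipS.
move=> step.
apply: le_trans step _; rewrite big_ord_recr /= (mulrDr noise) [leRHS]addrA.
apply: lerD.
  apply: le_trans IH; rewrite le_eqVlt -natr1 -addrA; apply/orP; left; apply/eqP.
  by have -> : 1 + 1 = 2 :> R by lra.
rewrite [leRHS]mulrA ler_wpM2r ?dot_ge0// -[k.+1%:R]natr1.
have kk0 : 0 <= k%:R :> R by [].
move: (k%:R : R) kk0 => x x0.
have -> : eta k * (x + 1 + 1) * ((x + 1) / (M * eta k ^+ 2) + (x + 1 + 2)) =
    (x + 2) * ((x + 1) * (M * eta k)^-1 + (x + 3) * eta k).
  by field; rewrite !gt_eqF.
have -> : noise * ((x + 1) * (x + 2)) = (x + 2) * ((x + 1) * noise).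
  by rewrite mulrC (mulrC (x + 1)) -mulrA.
rewrite ler_pM2l; last lra.
rewrite /noise mulrDr; apply: lerD.
  apply: ler_wpM2l; first lra.
  by rewrite lef_pV2 ?posrE ?(mulr_gt0 M0)// ler_pM2l.
by rewrite [leRHS]mulrA; apply: ler_pM => //; [lra|exact: ltW|lra].
Qed.

(** The inner product in the potential is nonnegative around the solution, so it
    costs only [|F (u k)| |u0 - u*|] and Young's inequality applies. *)
Lemma halpern_residual k :
  norm2 (F (u k)) + norm2 (F (u k) - G k) <=
    4 / (el * ((k%:R + 1) * (k%:R + 2))) *
    ((el^-1 + eta0 * L ^+ 2) * norm2 (u0 - ustar) + eta0 * norm2 (G 0 - F (v 0)) +
     noise * \sum_(j < k) (j%:R + 1) * (j%:R + 2) * norm2 (G j.+1 - F (v j.+1))).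
Proof.
have k0 : 0 <= k%:R :> R by [].
have := halpern_potential k; set V := _ * \sum_(_ < _) _.
set S := norm2 (F (u k)) + _; have S0 : norm2 (F (u k)) <= S.
  by rewrite /S lerDl dot_ge0.
have := mono (u k) ustar; rewrite Fstar subr0.
have -> : u k - ustar = (u k - u0) + (u0 - ustar) by rewrite addrA subrK.
rewrite dotDr; have := dot_young dot (F (u k)) (u0 - ustar)
  (a := el * (k%:R + 2) / 2).
set a := el * (k%:R + 2) / 2 => young.
have a0 : 0 < a by rewrite /a divr_gt0// mulr_gt0// ltr_wpDl.
move: {young}(young a0) S0; set p := dot (F (u k)) (u k - u0).
set q := dot (F (u k)) (u0 - ustar); set D := norm2 (u0 - ustar).
set x := norm2 (F (u k)); set e0 := norm2 (G 0 - F (v 0)) => young xS pq pot.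
have D0 : 0 <= D by exact: dot_ge0.
have x0 : 0 <= x by exact: dot_ge0.
have el_eta : el <= eta k by exact: stepsize_ge.
have aE : a = el * (k%:R + 2) / 2 by [].
move: (k%:R : R) k0 a a0 aE young pot => y y0 a a0 aE young pot.
have lower : el * ((y + 1) * (y + 2)) / 2 * S - (y + 1) * q <=
    eta k * ((y + 1) * (y + 2)) / 2 * S + (y + 1) * p.
  have : el * ((y + 1) * (y + 2)) / 2 * S <= eta k * ((y + 1) * (y + 2)) / 2 * S.
    apply: ler_wpM2r; first by rewrite (le_trans x0).
    by apply: ler_wpM2r => //; apply: ler_wpM2r => //; rewrite mulr_ge0; lra.
  have : 0 <= (y + 1) * (p + q) by rewrite mulr_ge0//; lra.
  lra.
have cross : (y + 1) * q <= el * ((y + 1) * (y + 2)) / 4 * S + el^-1 * D.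
  have : (y + 1) * (2 * q) <= (y + 1) * (a * S + a^-1 * D).
    apply: ler_wpM2l; first lra.
    by apply: le_trans young _; rewrite lerD2r ler_pM2l.
  have : (y + 1) * a^-1 * D <= 2 * el^-1 * D.
    apply: ler_wpM2r => //; rewrite aE invf_div invfM [leLHS]mulrC.
    rewrite -mulrA -mulrA ler_pM2l// -[leRHS]mulr1 ler_pM2l ?invr_gt0//.
    by rewrite mulrC ler_pdivrMr; lra.
  by rewrite aE; lra.
have P0 : 0 < el * ((y + 1) * (y + 2)) by rewrite (mulr_gt0 el0)// mulr_gt0// ltr_wpDl.
rewrite -[leLHS](mulKf (x := el * ((y + 1) * (y + 2)) / 4)); last first.
  by rewrite gt_eqF// divr_gt0.
rewrite invf_div ler_wpM2l ?divr_ge0 ?(ltW P0)//.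
lra.
Qed.

Definition scaled_estimate k := (k%:R + 1) ^+ 2 * eta0 ^+ 2 * norm2 (G k).

(** The iterates are running averages of [- (k + 1) eta_(k - 1) G k] around the
    anchor, so they stay as close to it as these vectors are short. *)
Lemma halpern_displacement k : norm2 (u k.+1 - u0) <=
  (1 - k.+2%:R^-1) * norm2 (u k - u0) + k.+2%:R^-1 * scaled_estimate k.+1.
Proof.
have k0 : 0 <= k%:R :> R by [].
have k2 : k.+2%:R = k%:R + 2 :> R by rewrite -addn2 natrD.
have k1 : k.+1%:R = k%:R + 1 :> R by rewrite -natr1.
have E : u k.+1 - u0 = (1 - k.+2%:R^-1) *: (u k - u0) +
    k.+2%:R^-1 *: (- (k.+2%:R * eta k) *: G k.+1).
  rewrite displacement scalerA mulrN mulrA mulVf ?pnatr_eq0// mul1r scaleNr.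
  by congr (_ *: _ - _); rewrite k1 k2; field; lra.
rewrite E; apply: le_trans (dot_convex dot _ _ _) _.
  by rewrite invr_ge0 ler0n invf_le1 ?ltr0n// ler1n.
rewrite lerD2l ler_wpM2l ?invr_ge0// dotZl dotZr /scaled_estimate mulrA.
rewrite ler_wpM2r ?dot_ge0// mulrNN -expr2 exprMn [k.+1%:R + 1]natr1.
rewrite ler_wpM2l ?sqr_ge0// ler_pXn2r// nnegrE ltW//.
Qed.

Lemma halpern_step_length0 : norm2 (v 1%N - v 0%N) <= scaled_estimate 0.
Proof.
have -> : v 1%N - v 0%N = - (eta 0 *: G 0%N).
  rewrite vS u_0 v_0 -scalerDl (_ : 2%:R^-1 + _ = 1) ?scale1r; last by field.
  by rewrite addrAC subrr add0r.
rewrite dotNl dotNr opprK dotZl dotZr mulrA -expr2 /scaled_estimate.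
by rewrite add0r expr1n mul1r ler_wpM2r ?dot_ge0// ler_pXn2r ?nnegrE ?(ltW (eta_gt0 _))// ltW.
Qed.

Lemma halpern_step_length k :
  k.+2%:R ^+ 2 * norm2 (v k.+2 - v k.+1) <=
    3 * norm2 (u k.+1 - u0) + 12 * scaled_estimate k.+1 + 12 * scaled_estimate k.
Proof.
have k0 : 0 <= k%:R :> R by [].
have e1 := eta_le k; have e2 := eta_le k.+1.
have e10 := eta_gt0 k; have e20 := eta_gt0 k.+1.
have k3E : k.+3%:R = k%:R + 3 :> R by rewrite -addn3 natrD.
have k2E : k.+2%:R = k%:R + 2 :> R by rewrite -addn2 natrD.
have k1E : k.+1%:R = k%:R + 1 :> R by rewrite -natr1.
have E : v k.+2 - v k.+1 = (- k.+3%:R^-1) *: (u k.+1 - u0) +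
    (- (eta k.+1 + eta k)) *: G k.+1 + eta k *: G k.
  have -> : v k.+2 - v k.+1 = (v k.+2 - u k.+1) + (u k.+1 - v k.+1).
    by rewrite addrA subrK.
  rewrite extrapolation_gap vS; apply/rowP => j; rewrite !mxE k3E k2E.
  by field; lra.
have := dot_sum3 dot ((- k.+3%:R^-1) *: (u k.+1 - u0))
  ((- (eta k.+1 + eta k)) *: G k.+1) (eta k *: G k).
rewrite -E !(dotZl, dotZr) /scaled_estimate k3E k2E k1E.
have := dot_ge0 dot (u k.+1 - u0); have := dot_ge0 dot (G k.+1).
have := dot_ge0 dot (G k).
move: (norm2 (v k.+2 - _)) (norm2 (u _ - _)) (norm2 (G k.+1)) (norm2 (G k)).
move: (eta k) (eta k.+1) (k%:R : R) k0 e1 e2 e10 e20 => a b x x0 ae be a0 b0 V U G1 G0.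
move=> G00 G10 U0 h.
have a2 : a ^+ 2 <= eta0 ^+ 2 by rewrite ler_pXn2r// nnegrE ltW.
have ab2 : (b + a) ^+ 2 <= 4 * eta0 ^+ 2.
  have -> : 4 * eta0 ^+ 2 = (2 * eta0) ^+ 2 by ring.
  by rewrite ler_pXn2r// ?nnegrE; lra.
have h1 : (x + 2) ^+ 2 * (3 * (- (x + 3)^-1 * (- (x + 3)^-1 * U))) <= 3 * U.
  rewrite [leLHS](_ : _ = 3 * (((x + 2) / (x + 3)) ^+ 2 * U)); last by field; lra.
  rewrite ler_pM2l// -[leRHS]mul1r ler_wpM2r// expr_le1// ?divr_ge0; try lra.
  by rewrite ler_pdivrMr; lra.
have h2 : (x + 2) ^+ 2 * (3 * (- (b + a) * (- (b + a) * G1))) <=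
    12 * ((x + 1 + 1) ^+ 2 * eta0 ^+ 2 * G1).
  have -> : x + 1 + 1 = x + 2 by lra.
  rewrite [leLHS](_ : _ = 3 * ((x + 2) ^+ 2 * (b + a) ^+ 2 * G1)); last by ring.
  have : (x + 2) ^+ 2 * (b + a) ^+ 2 * G1 <= (x + 2) ^+ 2 * (4 * eta0 ^+ 2) * G1.
    by rewrite ler_wpM2r// ler_wpM2l// sqr_ge0.
  lra.
have h3 : (x + 2) ^+ 2 * (3 * (a * (a * G0))) <= 12 * ((x + 1) ^+ 2 * eta0 ^+ 2 * G0).
  rewrite [leLHS](_ : _ = 3 * ((x + 2) ^+ 2 * a ^+ 2 * G0)); last by ring.
  have : (x + 2) ^+ 2 * a ^+ 2 * G0 <= (4 * (x + 1) ^+ 2) * eta0 ^+ 2 * G0.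
    rewrite ler_wpM2r//; apply: ler_pM => //; rewrite ?sqr_ge0//.
    have -> : 4 * (x + 1) ^+ 2 = (2 * (x + 1)) ^+ 2 by ring.
    by rewrite ler_pXn2r// ?nnegrE; lra.
  lra.
have : (x + 2) ^+ 2 * V <= (x + 2) ^+ 2 * (3 * (- (x + 3)^-1 * (- (x + 3)^-1 * U)) +
    3 * (- (b + a) * (- (b + a) * G1)) + 3 * (a * (a * G0))).
  by rewrite ler_wpM2l// sqr_ge0.
rewrite !mulrDr; lra.
Qed.

End Trajectory.

(** * One call in mean *)

Section Call.
Context {R : realType} {d : nat} (dot : {dot 'rV[R]_d for idfun}).
Context {dO : measure_display} {Omega : measurableType dO} (P : probability Omega R).
Context {dZ : measure_display} {Z : measurableType dZ} (Pz : probability Z R).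
Context (F : 'rV[R]_d -> 'rV[R]_d) (Fhat : 'rV[R]_d -> Z -> 'rV[R]_d).
Context (sigma L eta0 : R) (ustar : 'rV[R]_d).
Context (z : nat -> nat -> nat -> {RV P >-> Z}) (c : nat -> nat -> {RV P >-> bool}).
Hypothesis oracle : stochastic_oracle dot Pz F Fhat sigma L.
Hypothesis rnd : algorithm_randomness Pz z c.
Hypotheses (L0 : 0 < L) (eta0_gt0 : 0 < eta0).
Hypothesis small : Defs.coefM L * eta0 ^+ 2 <= 3^-1.
Hypothesis mono : monotone_operator dot F.
Hypothesis lip : lipschitz_operator dot L F.
Hypothesis Fstar : F ustar = 0.
Context (n : nat) (eps : R) (U : Omega -> 'rV[R]_d) (D2 : R).
Hypothesis mU : measurable_vec (U : known z c (past n 0) -> _).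
Hypothesis eps0 : 0 < eps.
Local Notation norm2 x := (dot x x).
Hypothesis UD2 : mean_le P (fun w => norm2 (U w - ustar)) D2.
Local Notation M := (Defs.coefM L).
Local Notation el := (eta_low M eta0).
Local Notation st k w := (call_state dot Fhat sigma L eta0 z c n eps U k w).
Local Notation G k w := (st_est (st k w)).
Local Notation Fu k w := (F (st_u (st k w))).
#[local] Opaque eta_low stepsize.

Let M0 : 0 < M. Proof. by rewrite mulr_gt0// exprn_gt0. Qed.
Let el0 : 0 < el. Proof. exact: eta_low_gt0. Qed.

Let D20 : 0 <= D2.
Proof.
case: UD2 => _ U0 UD; rewrite -lee_fin; apply: le_trans UD.
by apply: integral_ge0 => w _; rewrite lee_fin.
Qed.

Let mst k : [/\ measurable_vec (fun w => st_u (st k w)),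
  measurable_vec (fun w => st_v (st k w)), measurable_vec (fun w => G k w) &
  measurable_fun setT (fun w => (st_queries (st k w))%:R : R)].
Proof.
have [mu mv mG mq] := measurable_call_state eta0 oracle eps mU k.
by split; [exact: known_vec mu|exact: known_vec mv|exact: known_vec mG|exact: known_fun mq].
Qed.

Let residual_bound k := 4 * (1 + L ^+ 2 * eta0 * el) /
  (el ^+ 2 * ((k%:R + 1) * (k%:R + 2))) * D2 +
  5 * (1 + M * el * eta0) / (M * el ^+ 2) * eps ^+ 2.

Lemma sum_ord_shift2 k : \sum_(j < k) (j%:R + 2) = k%:R * (k%:R + 3) / 2 :> R.
Proof.
elim: k => [|k IH]; first by rewrite big_ord0 !mul0r.
by rewrite big_ord_recr /= IH -natr1; field.
Qed.

(** Taking means in [halpern_residual]: the weight [(j + 1) (j + 2)] of the [j]-th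
    error is compensated by its decay, so that the noise grows like [k ^ 2], as
    fast as the weight of the residual. *)
Lemma call_residual k :
  mean_le P (fun w => norm2 (Fu k w) + norm2 (Fu k w - G k w)) (residual_bound k).
Proof.
have [mu mv mG _] := mst k.
have mF := measurable_operator oracle mu.
pose B w := 4 / (el * ((k%:R + 1) * (k%:R + 2))) *
  ((el^-1 + eta0 * L ^+ 2) * norm2 (U w - ustar) + eta0 * norm2 (G 0 w - F (st_v (st 0 w))) +
   ((M * el)^-1 + 3 * eta0) *
     \sum_(j < k) (j%:R + 1) * (j%:R + 2) * norm2 (G j.+1 w - F (st_v (st j.+1 w)))).
have err := estimation_error_bound eta0 oracle rnd mU eps0 L0.
have k0 : 0 <= k%:R :> R by [].
have c0 : 0 <= 4 / (el * ((k%:R + 1) * (k%:R + 2))).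
  by rewrite divr_ge0// (mulr_ge0 (ltW el0))// mulr_ge0; lra.
have noise0 : 0 <= (M * el)^-1 + 3 * eta0.
  by rewrite addr_ge0 ?invr_ge0 ?(mulr_ge0 (ltW M0) (ltW el0))// mulr_ge0// ltW.
have MB : mean_le P B (4 / (el * ((k%:R + 1) * (k%:R + 2))) *
    ((el^-1 + eta0 * L ^+ 2) * D2 + eta0 * (eps ^+ 2 / 1) +
     ((M * el)^-1 + 3 * eta0) * \sum_(j < k) (j%:R + 1) * (j%:R + 2) * (eps ^+ 2 / j.+1%:R))).
  apply: mean_leZ => //; apply: mean_leD; first apply: mean_leD.
  - apply: mean_leZ => //.
    by rewrite addr_ge0 ?invr_ge0 ?(ltW el0)// mulr_ge0 ?sqr_ge0// ltW.
  - by apply: mean_leZ; [exact: ltW|exact: err 0%N].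
  apply: mean_leZ => //.
  apply: (@mean_le_sum _ _ _ P k
    (fun j w => (j%:R + 1) * (j%:R + 2) * norm2 (G j.+1 w - F (st_v (st j.+1 w))))
    (fun j => (j%:R + 1) * (j%:R + 2) * (eps ^+ 2 / j.+1%:R))) => j _.
  apply: mean_leZ; first by rewrite mulr_ge0// addr_ge0.
  have -> : j.+1 = maxn 1 j.+1 by rewrite (maxn_idPr _).
  by have := err j.+1; rewrite (maxn_idPr _).
apply: mean_le_le (mean_leW _ MB).
- by apply: measurable_funD; apply: measurable_dot => //; exact: measurable_vecB.
- move=> w; rewrite addr_ge0 ?dot_ge0//=.
  exact: (@halpern_residual R d dot F L eta0 (U w) ustar (fun k => st_u (st k w))
    (fun k => st_v (st k w)) (fun k => G k w) L0 eta0_gt0 small mono lip Fstar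
    erefl erefl (fun=> erefl) (fun=> erefl) k).
have -> : \sum_(j < k) (j%:R + 1) * (j%:R + 2) * (eps ^+ 2 / j.+1%:R) =
    eps ^+ 2 * (k%:R * (k%:R + 3) / 2).
  rewrite -sum_ord_shift2 mulr_sumr; apply: eq_bigr => j _.
  have j0 : 0 <= j%:R :> R by [].
  by rewrite -natr1; field; lra.
rewrite /residual_bound divr1.
have Mel : M * el * eta0 <= 3^-1.
  apply: le_trans small; rewrite -mulrA ler_pM2l// expr2 ler_pM2r//.
  exact: eta_low_le.
have e20 : 0 <= eps ^+ 2 by exact: sqr_ge0.
move: (M) (el) M0 el0 Mel noise0 (k%:R : R) k0 => m l m0 l0 Ml N0 x x0.
have P0 : 0 < (x + 1) * (x + 2) by rewrite mulr_gt0; lra.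
have MLl : 0 < m * l by exact: mulr_gt0.
set N := (m * l)^-1 + 3 * eta0 in N0 *.
have etaN : eta0 <= N.
  have ml0 : 0 < (m * l)^-1 by rewrite invr_gt0.
  by have := eta0_gt0; rewrite /N; lra.
have -> : 4 / (l * ((x + 1) * (x + 2))) * ((l^-1 + eta0 * L ^+ 2) * D2 +
    eta0 * eps ^+ 2 + N * (eps ^+ 2 * (x * (x + 3) / 2))) =
    4 * (1 + L ^+ 2 * eta0 * l) / (l ^+ 2 * ((x + 1) * (x + 2))) * D2 +
    4 * (eta0 + N * (x * (x + 3) / 2)) / (l * ((x + 1) * (x + 2))) * eps ^+ 2.
  by field; lra.
rewrite lerD2l ler_wpM2r//.
apply: (@le_trans _ _ (2 * N / l)).
  rewrite ler_pdivrMr; last exact: mulr_gt0.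
  rewrite [leRHS](_ : _ = 4 * (N + N * (x * (x + 3) / 2))); last by field; lra.
  by rewrite ler_pM2l// lerD2r.
rewrite ler_pdivrMr//.
rewrite [leRHS](_ : _ = 5 * (m * l)^-1 + 5 * eta0); last by field; lra.
rewrite /N.
have : eta0 <= (m * l)^-1.
  rewrite -[leRHS]mul1r ler_pdivlMr// mulrC; lra.
have : 0 < (m * l)^-1 by rewrite invr_gt0.
lra.
Qed.

(** The order of magnitude, uniform over the first [K] iterations, of the squared
    distance to the anchor and of [k ^ 2] times the squared length of the [k]-th
    step. *)
Definition call_scale K : R := 34 * D2 + 6 * (K%:R + 1) ^+ 2 * eps ^+ 2 / L ^+ 2.

Let call_scale_ge0 K : 0 <= call_scale K.
Proof.
rewrite /call_scale addr_ge0//; first by rewrite mulr_ge0 ?D20.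
by rewrite divr_ge0 ?sqr_ge0// mulr_ge0 ?sqr_ge0// mulr_ge0 ?sqr_ge0.
Qed.

(** The estimate is at most the residual plus its own deviation from it, both
    bounded by [call_residual].  The constants of [call_scale] come from
    [eta0 <= 2 el] and [L ^ 2 eta0 ^ 2 <= 1 / 27]. *)
Lemma call_scaled_estimate K k : (k <= K)%N ->
  mean_le P (fun w => scaled_estimate dot eta0 (fun k => G k w) k) (call_scale K).
Proof.
move=> kK; have [mu mv mG _] := mst k.
have h := mean_leZ (a := 2 * ((k%:R + 1) ^+ 2 * eta0 ^+ 2)) _ (call_residual k).
have {h} : mean_le P (fun w => 2 * ((k%:R + 1) ^+ 2 * eta0 ^+ 2) *
    (norm2 (Fu k w) + norm2 (Fu k w - G k w)))
    (2 * ((k%:R + 1) ^+ 2 * eta0 ^+ 2) * residual_bound k).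
  by apply: h; rewrite mulr_ge0// mulr_ge0 ?sqr_ge0.
move=> h; apply: mean_le_le (mean_leW _ h).
- apply: measurable_funM; first exact: measurable_cst.
  exact: measurable_dot.
- have c0 : 0 <= (k%:R + 1) ^+ 2 * eta0 ^+ 2.
    by apply: mulr_ge0; exact: sqr_ge0.
  move=> w; rewrite /scaled_estimate (mulr_ge0 c0 (dot_ge0 _ _))/=.
  rewrite [leRHS]mulrAC [leRHS]mulrC; apply: (ler_wpM2l c0).
  have := dot_sum2 dot (G k w - Fu k w) (Fu k w); rewrite subrK.
  have -> : norm2 (G k w - Fu k w) = norm2 (Fu k w - G k w).
    by rewrite -opprB dotNl dotNr opprK.
  by rewrite -mulrDr addrC.
rewrite /residual_bound /call_scale.
have x0 : 0 <= k%:R :> R by [].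
have xK : (k%:R + 1) ^+ 2 <= (K%:R + 1) ^+ 2 :> R.
  by rewrite ler_pXn2r ?nnegrE ?addr_ge0// lerD2r ler_nat.
have h2 : 6 * (k%:R + 1) ^+ 2 * eps ^+ 2 / L ^+ 2 <=
    6 * (K%:R + 1) ^+ 2 * eps ^+ 2 / L ^+ 2.
  rewrite ler_wpM2r ?invr_ge0 ?sqr_ge0// ler_wpM2r ?sqr_ge0// ler_wpM2l//.
apply: le_trans (lerD (lexx _) h2).
have ME : M = 9 * L ^+ 2 by [].
have lge := eta_low_ge eta0_gt0 small; have lle := eta_low_le M0 eta0_gt0 small.
have sm : 9 * L ^+ 2 * eta0 ^+ 2 <= 3^-1 by exact: small.
move: (el) el0 lge lle => l l0 lge lle; rewrite ME.
have e0 := eta0_gt0; have LL := L0; have D0 := D20; have ep := eps0.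
move: (k%:R : R) x0 => x x0.
have r1 : eta0 ^+ 2 <= 4 * l ^+ 2.
  have -> : 4 * l ^+ 2 = (2 * l) ^+ 2 by ring.
  by rewrite ler_pXn2r// ?nnegrE; lra.
have sl : L ^+ 2 * eta0 * l <= 27^-1.
  have : L ^+ 2 * eta0 * l <= L ^+ 2 * eta0 ^+ 2.
    by rewrite -mulrA (expr2 eta0) ler_pM2l ?exprn_gt0// ler_pM2l.
  lra.
have l2 : 0 < l ^+ 2 by rewrite exprn_gt0.
have rr : eta0 ^+ 2 / l ^+ 2 <= 4 by rewrite ler_pdivrMr.
have rr0 : 0 <= eta0 ^+ 2 / l ^+ 2 by rewrite divr_ge0 ?sqr_ge0.
rewrite [leLHS](_ : _ = 8 * ((1 + L ^+ 2 * eta0 * l) * (eta0 ^+ 2 / l ^+ 2)) *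
    ((x + 1) / (x + 2)) * D2 +
    10 / 9 * ((1 + 9 * (L ^+ 2 * eta0 * l)) * (eta0 ^+ 2 / l ^+ 2)) *
    ((x + 1) ^+ 2 * eps ^+ 2 / L ^+ 2)); last by field; lra.
have s0 : 0 <= L ^+ 2 * eta0 * l by rewrite mulr_ge0 ?mulr_ge0 ?sqr_ge0 ?ltW.
apply: lerD.
  apply: ler_wpM2r => //.
  have : (1 + L ^+ 2 * eta0 * l) * (eta0 ^+ 2 / l ^+ 2) <= (1 + 27^-1) * 4.
    by apply: ler_pM => //; lra.
  have x2 : 0 < x + 2 by exact: ltr_wpDl.
  have q1 : (x + 1) / (x + 2) <= 1 by rewrite ler_pdivrMr// mul1r lerD2l ler1n.
  move=> h'; have : 8 * ((1 + L ^+ 2 * eta0 * l) * (eta0 ^+ 2 / l ^+ 2)) *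
      ((x + 1) / (x + 2)) <= 8 * ((1 + 27^-1) * 4) * 1.
    apply: ler_pM => //; last by rewrite ler_pM2l.
      by rewrite mulr_ge0// mulr_ge0// addr_ge0.
    by rewrite divr_ge0 ?addr_ge0// ltW.
  lra.
have -> : 6 * (x + 1) ^+ 2 * eps ^+ 2 / L ^+ 2 = 6 * ((x + 1) ^+ 2 * eps ^+ 2 / L ^+ 2).
  by rewrite !mulrA.
apply: ler_wpM2r; first by rewrite divr_ge0 ?sqr_ge0// mulr_ge0 ?sqr_ge0.
have : (1 + 9 * (L ^+ 2 * eta0 * l)) * (eta0 ^+ 2 / l ^+ 2) <= (1 + 9 * 27^-1) * 4.
  by apply: ler_pM => //; lra.
lra.
Qed.

Lemma call_displacement K k : (k <= K)%N ->
  mean_le P (fun w => norm2 (st_u (st k w) - U w)) (call_scale K).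
Proof.
have mU' := known_vec mU.
have mdisp j : measurable_fun setT (fun w => norm2 (st_u (st j w) - U w)).
  have [mu _ _ _] := mst j.
  by apply: measurable_dot; exact: measurable_vecB.
elim: k => [_|k IH kK].
  apply: mean_le_le (mean_le_cst P (call_scale_ge0 K)) => // w.
  by rewrite dot_ge0 andTb subrr dot0l.
have := mean_leD (mean_leZ (a := 1 - k.+2%:R^-1) _ (IH (ltnW kK)))
  (mean_leZ (a := k.+2%:R^-1) _ (call_scaled_estimate kK)).
rewrite subr_ge0 invf_le1 ?ltr0n// ler1n invr_ge0 ler0n => /(_ isT isT).
rewrite -mulrDl subrK mul1r; apply: mean_le_le => // w; rewrite dot_ge0 andTb.
exact: (@halpern_displacement R d dot L eta0 (U w) (fun k => st_u (st k w))
    (fun k => G k w) L0 eta0_gt0 small (fun=> erefl) k).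
Qed.

Lemma call_step_length K k : (k < K)%N ->
  mean_le P (fun w => k.+1%:R ^+ 2 * norm2 (st_v (st k.+1 w) - st_v (st k w)))
    (27 * call_scale K).
Proof.
move=> kK; have mstep : measurable_fun setT
    (fun w => k.+1%:R ^+ 2 * norm2 (st_v (st k.+1 w) - st_v (st k w))).
  have [_ mv _ _] := mst k; have [_ mv' _ _] := mst k.+1.
  apply: measurable_funM; first exact: measurable_cst.
  by apply: measurable_dot; exact: measurable_vecB.
have step0 w : 0 <= k.+1%:R ^+ 2 * norm2 (st_v (st k.+1 w) - st_v (st k w)).
  by rewrite mulr_ge0 ?sqr_ge0 ?dot_ge0.
have S0 := call_scale_ge0 K.
case: k => [|k] in kK mstep step0 *.
  apply: mean_le_le (mean_leW _ (call_scaled_estimate (leq0n K))) => //; last lra.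
  move=> w; rewrite step0 andTb expr1n mul1r.
  exact: (@halpern_step_length0 R d dot L eta0 (U w) (fun k => st_u (st k w))
    (fun k => st_v (st k w)) (fun k => G k w) erefl erefl (fun=> erefl)).
have := mean_leD (mean_leD (mean_leZ (a := 3) _ (call_displacement (ltnW kK)))
  (mean_leZ (a := 12) _ (call_scaled_estimate (ltnW kK))))
  (mean_leZ (a := 12) _ (call_scaled_estimate (ltnW (ltnW kK)))).
rewrite !ler0n => /(_ isT isT isT) h.
apply: mean_le_le (mean_leW _ h) => // [w|]; last lra.
rewrite step0 andTb.
exact: (@halpern_step_length R d dot L eta0 (U w) (fun k => st_u (st k w))
    (fun k => st_v (st k w)) (fun k => G k w) L0 eta0_gt0 small (fun=> erefl) (fun=> erefl) k).
Qed.

Lemma mean_le_coin k : (0 < k)%N -> mean_le P (fun w => (c n k w)%:R) (coin_prob k).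
Proof.
move=> k0; split => //.
  exact: (measurableT_comp (f := fun b : bool => b%:R : R)).
rewrite -(coin_law rnd n k0) -[X in (_ <= P X)%E]setIT -integral_indic//; last first.
  rewrite (_ : [set w | _] = c n k @^-1` [set true])//.
  by rewrite -[X in measurable X]setTI; exact: measurable_funPT.
rewrite le_eqVlt; apply/orP; left; apply/eqP; apply: eq_integral => w _.
rewrite indicE; case: (boolP (c n k w)) => cw; first by rewrite mem_set.
by rewrite memNset//; exact/negP.
Qed.

(** Every iteration costs at most [8 sigma^2 / eps^2] samples in mean for a fresh
    batch, since its size is inversely proportional to its probability, plus the
    size of the correction batch, which the length of the step controls. *)
Lemma call_queries k K : (k <= K)%N ->
  mean_le P (fun w => (st_queries (st k w))%:R)
    ((k%:R + 1) * (8 * sigma ^+ 2 / eps ^+ 2 + 1) +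
     k%:R * (432 * (L ^+ 2 * call_scale K / eps ^+ 2) + 2)).
Proof.
have e2 : 0 < eps ^+ 2 by exact: exprn_gt0.
have s2 : 0 <= 8 * sigma ^+ 2 by rewrite mulr_ge0 ?sqr_ge0.
have q0 (x : R) : 0 < x -> 0 <= 8 * sigma ^+ 2 / x by move=> /ltW; exact: divr_ge0.
elim: k => [_|k IH kK].
  have [_ _ _ mq] := mst 0; rewrite add0r !mul1r mul0r addr0.
  apply: mean_le_le (mean_le_cst P _) => //.
    by move=> w; rewrite ler0n andTb; apply: batch_size_ub; exact: q0.
  by rewrite addr_ge0// q0.
have [_ _ _ mq] := mst k.+1.
have p0 : 0 < coin_prob k.+1 :> R by exact: coin_prob_gt0.
pose p : R := coin_prob k.+1.
have pk : p^-1 <= k.+1%:R.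
  by rewrite -[leRHS]invrK lef_pV2 ?posrE ?invr_gt0 ?ltr0n// coin_prob_ge.
have := mean_leD (IH (ltnW kK)) (mean_leD
  (mean_leZ (a := 8 * sigma ^+ 2 / (p * eps ^+ 2) + 1) _ (mean_le_coin (ltn0Sn k)))
  (mean_leD (mean_leZ (a := 16 * (L ^+ 2 / eps ^+ 2)) _ (call_step_length kK))
    (mean_le_cst P (ler0n R 2)))).
have a0 : 0 <= 8 * sigma ^+ 2 / (p * eps ^+ 2) + 1.
  by rewrite addr_ge0// q0// mulr_gt0.
rewrite a0 mulr_ge0 ?divr_ge0 ?sqr_ge0// => /(_ isT isT) h.
apply: mean_le_le (mean_leW _ h) => // [w|].
  rewrite ler0n natrD lerD2l; set S2 := nceil _.
  have S2le : (2 * S2)%:R <= 16 * (L ^+ 2 / eps ^+ 2) *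
      (k.+1%:R ^+ 2 * norm2 (st_v (st k.+1 w) - st_v (st k w))) + 2.
    rewrite natrM; set V := norm2 _.
    have V0 : 0 <= V by exact: dot_ge0.
    have : S2%:R <= 8 * L ^+ 2 * V / (p ^+ 2 * eps ^+ 2) + 1.
      rewrite /S2 dnormE -/p; apply: nceil_ub.
      by rewrite divr_ge0// mulr_ge0 ?sqr_ge0// mulr_ge0 ?sqr_ge0.
    have -> : 8 * L ^+ 2 * V / (p ^+ 2 * eps ^+ 2) =
        8 * (L ^+ 2 / eps ^+ 2) * (p^-1 ^+ 2 * V).
      by field; rewrite (gt_eqF p0) (gt_eqF eps0).
    have : 8 * (L ^+ 2 / eps ^+ 2) * (p^-1 ^+ 2 * V) <=
        8 * (L ^+ 2 / eps ^+ 2) * (k.+1%:R ^+ 2 * V).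
      apply: ler_wpM2l; first by rewrite mulr_ge0// divr_ge0 ?sqr_ge0.
      apply: ler_wpM2r => //.
      by rewrite ler_pXn2r ?nnegrE ?invr_ge0 ?(ltW p0).
    lra.
  case: (c n k.+1 w); last by rewrite mulr0 add0r.
  rewrite mulr1 -[leLHS]addr0; apply: lerD; last by apply: le_trans S2le.
  by apply: batch_size_ub; rewrite q0// mulr_gt0.
have -> : (8 * sigma ^+ 2 / (p * eps ^+ 2) + 1) * coin_prob k.+1 =
    8 * sigma ^+ 2 / eps ^+ 2 + p.
  by rewrite -/p; field; rewrite !gt_eqF.
have p1 : p <= 1 by exact: coin_prob_le1.
rewrite -[k.+1%:R]natr1.
have -> : 16 * (L ^+ 2 / eps ^+ 2) * (27 * call_scale K) =
    432 * (L ^+ 2 * call_scale K / eps ^+ 2).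
  by have e0 := eps0; have LL := L0; rewrite /call_scale; field; lra.
lra.
Qed.

End Call.

(** * Accuracy and length of the calls *)

Section CallTuning.
Context {R : realType} (L mu eta0 eps : R).
Hypotheses (L0 : 0 < L) (mu0 : 0 < mu) (eps0 : 0 < eps) (eta0_gt0 : 0 < eta0).
Hypothesis small : Defs.coefM L * eta0 ^+ 2 <= 3^-1.
Local Notation M := (Defs.coefM L).
Local Notation el := (eta_low M eta0).
Local Notation er := (restart_accuracy L mu eta0 eps).
Local Notation K := (restart_inner L mu eta0).
#[local] Opaque eta_low.

Let M0 : 0 < M. Proof. by rewrite mulr_gt0// exprn_gt0. Qed.
Let el0 : 0 < el. Proof. exact: eta_low_gt0. Qed.
Let Mle0 : 0 < M * el * eta0. Proof. by rewrite (mulr_gt0 _ eta0_gt0) ?(mulr_gt0 M0 el0). Qed.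

Lemma restart_accuracy_gt0 : 0 < er.
Proof.
have h : 0 < M * el ^+ 2 by rewrite (mulr_gt0 M0) ?exprn_gt0.
have h' : 0 < 5 * (1 + M * el * eta0) by rewrite pmulr_rgt0// addr_gt0.
rewrite /restart_accuracy /=; apply: divr_gt0; first by rewrite !mulr_gt0// sqrtr_gt0.
by rewrite pmulr_rgt0// sqrtr_gt0.
Qed.

Lemma restart_accuracy2 :
  er ^+ 2 = mu ^+ 2 * eps ^+ 2 * (M * el ^+ 2) / (20 * (1 + M * el * eta0)).
Proof.
have h : 0 <= M * el ^+ 2 by rewrite (mulr_ge0 (ltW M0)) ?sqr_ge0.
have h' : 0 <= 5 * (1 + M * el * eta0) by rewrite mulr_ge0// addr_ge0// ltW.
have s0 : 0 < 1 + M * el * eta0 by rewrite addr_gt0.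
rewrite /restart_accuracy /=.
move: (M * el ^+ 2) (1 + M * el * eta0) h h' s0 => x s x0 s5 s0.
by rewrite expr_div_n !exprMn !sqr_sqrtr//; field; lra.
Qed.

Lemma restart_inner_ge :
  16 * (1 + L ^+ 2 * eta0 * el) <= mu ^+ 2 * el ^+ 2 * K%:R ^+ 2.
Proof.
have := nceil_ge (4 * Num.sqrt (L ^+ 2 * eta0 * el + 1) / (mu * el)).
rewrite -/K ler_pdivrMr ?(mulr_gt0 mu0 el0)// => h.
have s0 : 0 <= L ^+ 2 * eta0 * el + 1.
  by rewrite addr_ge0// (mulr_ge0 _ (ltW el0))// mulr_ge0 ?sqr_ge0// ltW.
have : (4 * Num.sqrt (L ^+ 2 * eta0 * el + 1)) ^+ 2 <= (K%:R * (mu * el)) ^+ 2.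
  rewrite ler_pXn2r// nnegrE; first by rewrite mulr_ge0// sqrtr_ge0.
  by rewrite mulr_ge0// ltW// (mulr_gt0 mu0 el0).
rewrite !exprMn sqr_sqrtr//; lra.
Qed.

Let a := L * eta0.
Let a0 : 0 < a. Proof. by rewrite mulr_gt0. Qed.

Let a27 : a ^+ 2 <= 27^-1.
Proof.
have h : 9 * L ^+ 2 * eta0 ^+ 2 <= 3^-1 := small.
by rewrite /a exprMn; lra.
Qed.

Let a1 : a <= 1.
Proof. by rewrite -(@expr_le1 _ 2)// ?(ltW a0)//; have h := a27; lra. Qed.

(** As [el] is comparable to [eta0], a call has a length of order
    [1 / (mu eta0)]; the product [L eta0] is split off from [L / mu]. *)
Lemma restart_inner_le : mu <= L -> K%:R + 1 <= 12 * (L * eta0)^-1 * (L / mu).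
Proof.
move=> muL; rewrite -/a; have h27 := a27; have h0 := a0; have h1 := a1.
have hge := eta_low_ge eta0_gt0 small; have hle := eta_low_le M0 eta0_gt0 small.
have s0 : 0 <= L ^+ 2 * eta0 * el + 1.
  by rewrite addr_ge0// (mulr_ge0 _ (ltW el0))// mulr_ge0 ?sqr_ge0// ltW.
have s1 : Num.sqrt (L ^+ 2 * eta0 * el + 1) <= 5 / 4.
  rewrite -[leRHS]ger0_norm// -sqrtr_sqr ler_wsqrtr//.
  have : L ^+ 2 * eta0 * el <= a ^+ 2.
    rewrite /a exprMn (expr2 eta0) -mulrA ler_wpM2l ?sqr_ge0//.
    by rewrite ler_wpM2l// ltW.
  lra.
have d0 := mulr_gt0 mu0 el0.
have ub : K%:R <= 4 * Num.sqrt (L ^+ 2 * eta0 * el + 1) / (mu * el) + 1.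
  by apply: nceil_ub; rewrite divr_ge0 ?(ltW d0)// mulr_ge0// sqrtr_ge0.
have main : 4 * Num.sqrt (L ^+ 2 * eta0 * el + 1) / (mu * el) <= 10 * a^-1 * (L / mu).
  rewrite ler_pdivrMr//.
  have -> : 10 * a^-1 * (L / mu) * (mu * el) = 10 * el / eta0.
    by rewrite /a; have := L0; have := mu0; have := eta0_gt0; move=> *; field; lra.
  rewrite ler_pdivlMr//.
  have : Num.sqrt (L ^+ 2 * eta0 * el + 1) * eta0 <= 5 / 4 * eta0.
    by rewrite ler_wpM2r// ltW.
  lra.
have r1 : 1 <= a^-1 * (L / mu).
  have ha : 1 <= a^-1 by rewrite -invr1 lef_pV2 ?posrE.
  have hr : 1 <= L / mu by rewrite ler_pdivlMr ?mul1r.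
  by rewrite -[leLHS]mulr1; apply: ler_pM.
lra.
Qed.

Lemma restart_accuracy_inv :
  (er ^+ 2)^-1 <= 12 * (L * eta0)^-1 ^+ 2 / (mu ^+ 2 * eps ^+ 2).
Proof.
rewrite -/a; have h0 := a0; have h27 := a27.
have hge := eta_low_ge eta0_gt0 small; have hle := eta_low_le M0 eta0_gt0 small.
have p1 : 0 < mu ^+ 2 * eps ^+ 2 by rewrite mulr_gt0 ?exprn_gt0.
rewrite -[leRHS]invrK lef_pV2 ?posrE ?exprn_gt0 ?restart_accuracy_gt0//; last first.
  by rewrite invr_gt0 divr_gt0// mulr_gt0// exprn_gt0// invr_gt0.
have -> : (12 * a^-1 ^+ 2 / (mu ^+ 2 * eps ^+ 2))^-1 =
    mu ^+ 2 * eps ^+ 2 * (a ^+ 2 / 12).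
  by have h1 := mu0; have h2 := eps0; field; lra.
rewrite restart_accuracy2 -[leRHS]mulrA ler_pM2l//.
have Mel : M * el * eta0 <= 3^-1.
  apply: le_trans small; rewrite -mulrA ler_pM2l// expr2 ler_wpM2r//; exact: ltW.
have Mp := Mle0; rewrite ler_pdivlMr; last lra.
have : a ^+ 2 / 4 <= L ^+ 2 * el ^+ 2.
  rewrite /a exprMn -mulrA ler_wpM2l ?sqr_ge0//.
  have -> : eta0 ^+ 2 / 4 = (eta0 / 2) ^+ 2 by field.
  by rewrite ler_pXn2r// nnegrE ?(ltW el0)// divr_ge0// ltW.
have -> : M * el ^+ 2 = 9 * (L ^+ 2 * el ^+ 2) by rewrite mulrA.
have : a ^+ 2 / 12 * (20 * (1 + M * el * eta0)) <= a ^+ 2 / 12 * (20 * (1 + 3^-1)).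
  by rewrite ler_wpM2l ?divr_ge0 ?sqr_ge0//; lra.
have := sqr_ge0 a; lra.
Qed.

End CallTuning.

(** * Restarts *)

Section Restart.
Context {R : realType} {d : nat} (dot : {dot 'rV[R]_d for idfun}).
Context {dO : measure_display} {Omega : measurableType dO} (P : probability Omega R).
Context {dZ : measure_display} {Z : measurableType dZ} (Pz : probability Z R).
Context (F : 'rV[R]_d -> 'rV[R]_d) (Fhat : 'rV[R]_d -> Z -> 'rV[R]_d).
Context (sigma L mu eta0 eps : R) (u0 ustar : 'rV[R]_d).
Context (z : nat -> nat -> nat -> {RV P >-> Z}) (c : nat -> nat -> {RV P >-> bool}).
Hypothesis oracle : stochastic_oracle dot Pz F Fhat sigma L.
Hypothesis rnd : algorithm_randomness Pz z c.
Hypotheses (L0 : 0 < L) (mu0 : 0 < mu) (eps0 : 0 < eps) (eta0_gt0 : 0 < eta0).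
Hypothesis small : Defs.coefM L * eta0 ^+ 2 <= 3^-1.
Hypothesis mono : monotone_operator dot F.
Hypothesis lip : lipschitz_operator dot L F.
Hypothesis Fstar : F ustar = 0.
Hypothesis sharp : sharp_operator dot mu F ustar.
Local Notation norm2 x := (dot x x).
Local Notation M := (Defs.coefM L).
Local Notation el := (eta_low M eta0).
Local Notation er := (restart_accuracy L mu eta0 eps).
Local Notation K := (restart_inner L mu eta0).
Local Notation run m w := (restarted dot Fhat sigma L mu eta0 u0 eps
  (fun n k i => z n k i w) (fun n k => c n k w) m).
Local Notation call n := (call_state dot Fhat sigma L eta0 z c n.+1 er
  (fun w => (run n w).1) K).
#[local] Opaque eta_low stepsize restart_inner restart_accuracy.

Let M0 : 0 < M. Proof. by rewrite mulr_gt0// exprn_gt0. Qed.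
Let el0 : 0 < el. Proof. exact: eta_low_gt0. Qed.
Let er0 : 0 < er. Proof. exact: restart_accuracy_gt0. Qed.

Lemma restarted_pointS n w : (run n.+1 w).1 = st_u (call n w).
Proof. by rewrite /call_state /=; case: (run n w). Qed.

Lemma restarted_queriesS n w :
  (run n.+1 w).2 = ((run n w).2 + st_queries (call n w))%N.
Proof. by rewrite /call_state /=; case: (run n w). Qed.

Lemma known_restarted n :
  measurable_vec ((fun w => (run n w).1) : known z c (past n.+1 0) -> _).
Proof.
elim: n => [|n IH]; first exact: measurable_vec_cst.
have [mu' _ _ _] := measurable_call_state eta0 oracle er IH K.
have := known_vec_sub (@past_call n.+1 K.+1) mu'.
rewrite /measurable_vec => h j; apply: eq_measurable_fun (h j) => w _.
by rewrite restarted_pointS.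
Qed.

Lemma measurable_restarted_queries n :
  measurable_fun setT (fun w => (run n w).2%:R : R).
Proof.
elim: n => [|n IH]; first exact: measurable_cst.
have [_ _ _ mq] := measurable_call_state eta0 oracle er (@known_restarted n) K.
under eq_fun do rewrite restarted_queriesS natrD.
by apply: measurable_funD => //; exact: (known_fun mq).
Qed.

(** This turns the bound on the residual into one on the distance. *)
Lemma sharp_norm2 u : mu ^+ 2 * norm2 (u - ustar) <= norm2 (F u).
Proof.
have := sharp u; rewrite Fstar subr0 dnormE => h.
have := dot_young dot (F u) (u - ustar) (a := mu^-1); rewrite invr_gt0 invrK => /(_ mu0).
have N0 := dot_ge0 dot (u - ustar).
move: (dot (F u) _) (norm2 (u - ustar)) (norm2 (F u)) N0 h => p x y x0 h1 h2.
have : mu * (mu * x) <= mu * (mu^-1 * y) by rewrite ler_pM2l//; lra.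
by rewrite !mulrA divff ?gt_eqF// mul1r expr2.
Qed.

(** A call divides the mean squared distance to the solution by four, up to the
    target accuracy: the accuracy and the number of iterations of the calls are
    chosen so that the two terms of [call_residual] yield these two quarters. *)
Lemma restart_contraction n D2 :
  mean_le P (fun w => norm2 ((run n w).1 - ustar)) D2 ->
  mean_le P (fun w => norm2 ((run n.+1 w).1 - ustar)) (D2 / 4 + eps ^+ 2 / 4).
Proof.
move=> UD2.
have D20 : 0 <= D2.
  case: UD2 => _ U0 UD; rewrite -lee_fin; apply: le_trans UD.
  by apply: integral_ge0 => w _; rewrite lee_fin.
have mup : 0 < mu ^+ 2 by rewrite exprn_gt0.
have := mean_leZ (a := (mu ^+ 2)^-1) _ (call_residual oracle rnd L0 eta0_gt0 small mono
  lip Fstar (@known_restarted n) er0 UD2 K).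
rewrite invr_ge0 => /(_ (ltW mup)) h.
apply: mean_le_le (mean_leW _ h).
- have := known_vec (@known_restarted n.+1) => m1.
  by apply: measurable_dot; apply: measurable_vecB => //; exact: measurable_vec_cst.
- move=> w; rewrite dot_ge0 andTb restarted_pointS ler_pdivlMl//.
  apply: le_trans (sharp_norm2 _) _; rewrite lerDl; exact: dot_ge0.
rewrite restart_accuracy2// ler_pdivrMl//.
have Kge := restart_inner_ge mu0 eta0_gt0 small.
have s0 : 0 < 1 + M * el * eta0.
  by rewrite addr_gt0// (mulr_gt0 _ eta0_gt0)// (mulr_gt0 M0 el0).
have K0 : 0 <= K%:R :> R by [].
have Mp := M0; have ep := eps0.
move: (M) (el) (K%:R : R) Mp el0 s0 K0 Kge => m l k m0 l0 s0 k0 Kge.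
have l2 : 0 < l ^+ 2 by rewrite exprn_gt0.
rewrite [leRHS]mulrDr; apply: lerD.
  have -> : mu ^+ 2 * (D2 / 4) = mu ^+ 2 / 4 * D2 by field.
  rewrite ler_wpM2r//.
  rewrite ler_pdivrMr; last by rewrite !mulr_gt0//; lra.
  have kk : k ^+ 2 <= (k + 1) * (k + 2) by lra.
  have : mu ^+ 2 * l ^+ 2 * k ^+ 2 <= mu ^+ 2 * l ^+ 2 * ((k + 1) * (k + 2)).
    by rewrite ler_wpM2l// mulr_ge0// ltW.
  lra.
rewrite le_eqVlt; apply/orP; left; apply/eqP.
by field; lra.
Qed.

(** [eps ^ 2 / 3] is the fixed point of the contraction. *)
Lemma restart_mean n : mean_le P (fun w => norm2 ((run n w).1 - ustar))
  (4^-1 ^+ n * norm2 (u0 - ustar) + eps ^+ 2 / 3).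
Proof.
elim: n => [|n IH].
  rewrite expr0 mul1r; apply: mean_leW (mean_le_cst P (dot_ge0 dot (u0 - ustar))).
  by rewrite lerDl divr_ge0 ?sqr_ge0.
apply: mean_leW (restart_contraction IH).
by rewrite (exprS 4^-1); move: (4^-1 ^+ n) (norm2 _) => q D; lra.
Qed.

(** The cost of a call depends on the distance of its starting point to the
    solution.  These distances decay geometrically down to [eps], so the term
    [|u0 - ustar|^2] is counted once and not once per call. *)
Lemma restart_queries n : mean_le P (fun w => (run n w).2%:R)
  (n%:R * ((K%:R + 1) * (8 * sigma ^+ 2 / er ^+ 2 + 1) +
      K%:R * (432 * (34 / 3 * (L ^+ 2 * eps ^+ 2 / er ^+ 2) + 6 * (K%:R + 1) ^+ 2) + 2)) +
   (1 - 4^-1 ^+ n) * (K%:R * (432 * (136 / 3 * (L ^+ 2 * norm2 (u0 - ustar) / er ^+ 2))))).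
Proof.
elim: n => [|n IH].
  by rewrite mul0r subrr mul0r addr0; exact: mean_le_cst.
have := call_queries oracle rnd L0 eta0_gt0 small mono lip Fstar
  (@known_restarted n) er0 (restart_mean n) (leqnn K).
move=> /(mean_leD IH) h; apply: mean_le_le (mean_leW _ h).
- exact: measurable_restarted_queries.
- by move=> w; rewrite ler0n andTb restarted_queriesS natrD.
have -> : L ^+ 2 * call_scale L er (4^-1 ^+ n * norm2 (u0 - ustar) + eps ^+ 2 / 3) K /
      er ^+ 2 =
    34 * (4^-1 ^+ n * (L ^+ 2 * norm2 (u0 - ustar) / er ^+ 2)) +
    34 / 3 * (L ^+ 2 * eps ^+ 2 / er ^+ 2) + 6 * (K%:R + 1) ^+ 2.
  have LL := L0; have ee := er0; rewrite /call_scale.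
  move: (4^-1 ^+ n) (norm2 _) (K%:R : R) (er) ee => q D k e e0.
  by field; lra.
rewrite -[n.+1%:R]natr1 (exprS 4^-1).
move: (L ^+ 2 * norm2 _ / _) (L ^+ 2 * eps ^+ 2 / _) (8 * sigma ^+ 2 / _) => A B C.
move: (4^-1 ^+ n) (K%:R : R) (n%:R : R) => q k m.
move: ((k + 1) * (C + 1)) (6 * (k + 1) ^+ 2) (432 : R) => T s a.
lra.
Qed.

(** The number of calls is the least for which the contracted initial distance is
    at most [2 / 3 eps ^ 2], the room left by the fixed point. *)
Lemma restart_final :
  mean_le P (fun w => norm2 ((run (restart_calls dot u0 ustar eps) w).1 - ustar))
    (eps ^+ 2).
Proof.
apply: mean_leW (restart_mean _).
set D2 := norm2 (u0 - ustar); set N := restart_calls _ _ _ _.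
have contracted m : D2 * 6 <= 4 * eps ^+ 2 * 4 ^+ m ->
    4^-1 ^+ m * D2 + eps ^+ 2 / 3 <= eps ^+ 2.
  have p4 : 0 < 4 ^+ m :> R by rewrite exprn_gt0.
  rewrite exprVn mulrC => h.
  have : D2 / 4 ^+ m <= 2 / 3 * eps ^+ 2 by rewrite ler_pdivrMr//; lra.
  lra.
apply: contracted.
have := dot_ge0 dot (u0 - ustar); rewrite -/D2 le_eqVlt => /predU1P[<-|D0].
  rewrite mul0r; apply: mulr_ge0; last by rewrite exprn_ge0.
  by rewrite mulr_ge0 ?sqr_ge0.
pose x := Num.sqrt 6 * dnorm dot (u0 - ustar) / (2 * eps).
have x0 : 0 < x.
  apply: divr_gt0; last by rewrite mulr_gt0.
  by apply: mulr_gt0; rewrite sqrtr_gt0.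
have ln20 : 0 < ln 2 :> R by rewrite ln_gt0// ltr1n.
have xN : x <= 2 ^+ N.
  have := nceil_ge (log2 x); rewrite -[nceil _]/N /log2 ler_pdivrMr//.
  by rewrite mulr_natl -lnXn// ler_ln ?posrE// exprn_gt0.
move: (N) xN => m xm.
have : x ^+ 2 <= (2 ^+ m) ^+ 2 by rewrite ler_pXn2r// nnegrE ?(ltW x0)// exprn_ge0.
rewrite -exprM mulnC exprM (_ : 2 ^+ 2 = 4); last by ring.
move: (4 ^+ m) => p; have ep := eps0.
rewrite /x expr_div_n exprMn sqr_sqrtr// dnormE -/D2 exprMn ler_pdivrMr; first lra.
by rewrite mulr_gt0// exprn_gt0.
Qed.

End Restart.

(** * Complexity *)

Section Complexity.
Context {R : realType}.

Lemma coefM_small (L eta0 : R) : 0 < L -> 0 < eta0 <= (3 * Num.sqrt 3 * L)^-1 ->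
  Defs.coefM L * eta0 ^+ 2 <= 3^-1.
Proof.
move=> L0 /andP[e0 eL].
have s0 : 0 < 3 * Num.sqrt 3 * L by rewrite mulr_gt0// mulr_gt0// sqrtr_gt0.
have : eta0 * (3 * Num.sqrt 3 * L) <= 1 by rewrite -ler_pdivlMr// mul1r.
rewrite -(@expr_le1 _ 2)//; last by rewrite mulr_ge0 ?ltW.
rewrite !exprMn sqr_sqrtr// /Defs.coefM; lra.
Qed.

Lemma ln2_ge : 2^-1 <= ln 2 :> R.
Proof.
have := @le_ln1Dx R (- 2^-1).
have -> : 1 + - 2^-1 = 2^-1 :> R by lra.
rewrite lnV ?posrE// => /(_ _) h; rewrite -lerN2; apply: h; lra.
Qed.

Lemma restart_calls_le d (dot : {dot 'rV[R]_d for idfun}) (u0 ustar : 'rV[R]_d) (eps : R) :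
  0 < eps -> 0 < dnorm dot (u0 - ustar) -> 1 <= ln (dnorm dot (u0 - ustar) / eps) ->
  (restart_calls dot u0 ustar eps)%:R <= 4 * ln (dnorm dot (u0 - ustar) / eps).
Proof.
rewrite /restart_calls; move: (dnorm dot _) => D e0 D0 l1.
have De0 : 0 < D / eps by rewrite divr_gt0.
have s60 : 0 < Num.sqrt 6 / 2 :> R by rewrite divr_gt0// sqrtr_gt0.
have -> : Num.sqrt 6 * D / (2 * eps) = Num.sqrt 6 / 2 * (D / eps).
  by field; lra.
have s6 : Num.sqrt 6 / 2 <= 1 + 4^-1 :> R.
  rewrite ler_pdivrMr// -[leRHS]ger0_norm; last lra.
  by rewrite -sqrtr_sqr ler_wsqrtr//; lra.
have s61 : 1 <= Num.sqrt 6 / 2 :> R.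
  rewrite ler_pdivlMr// mul1r -[leLHS]ger0_norm// -sqrtr_sqr ler_wsqrtr//; lra.
have ln6 : ln (Num.sqrt 6 / 2) <= 4^-1 :> R.
  apply: (@le_trans _ _ (ln (1 + 4^-1))); last by apply: le_ln1Dx; lra.
  by rewrite ler_ln ?posrE//; lra.
have ln60 : 0 <= ln (Num.sqrt 6 / 2) :> R by exact: ln_ge0.
have ln2 := ln2_ge.
have lx : ln (Num.sqrt 6 / 2 * (D / eps)) = ln (Num.sqrt 6 / 2) + ln (D / eps).
  by apply: lnM; rewrite posrE.
rewrite /log2 lx.
apply: le_trans (nceil_ub _) _; first by rewrite divr_ge0//; lra.
have : (ln (Num.sqrt 6 / 2) + ln (D / eps)) / ln 2 <=
    2 * (ln (Num.sqrt 6 / 2) + ln (D / eps)).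
  rewrite ler_pdivrMr; last lra.
  rewrite mulrAC -[leLHS]mul1r ler_wpM2r//; lra.
lra.
Qed.

Lemma iteration_count (N k b r l : R) :
  0 <= N <= 4 * l -> 0 <= k -> k + 1 <= 12 * b * r -> 1 <= b -> 1 <= r -> 1 <= l ->
  N * k <= 1728 * (137 * 100) * b ^+ 3 * (r * l).
Proof.
move=> /andP[N0 Nl] k0 kT b1 r1 l1.
have : N * k <= 4 * l * (12 * b * r) by apply: ler_pM => //; lra.
have -> : 4 * l * (12 * b * r) = 48 * b * (r * l) by ring.
move=> /le_trans; apply; apply: ler_wpM2r; first by rewrite mulr_ge0//; lra.
have : b <= b ^+ 3 by rewrite -[leLHS]expr1 ler_weXn2l.
lra.
Qed.

(** The bounds on the number of calls, on the length of a call and on its accuracy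
    combined: [b] stands for [1 / (L eta0)], [r] for [L / mu], [l] for the logarithm,
    [q] for [(D / eps) ^ 2] and [T] bounds the length of a call.  The factor 1728 is
    [12 ^ 3], from [T ^ 3], and 13700 exceeds the sum of the constants in front of
    [q T ^ 3]. *)
Lemma query_count (N k A B C b r l q s T p : R) :
  0 <= N <= 4 * l -> 0 <= k -> k + 1 <= T -> T = 12 * b * r ->
  1 <= b -> 1 <= r -> 1 <= l <= q -> 0 <= s ->
  0 <= A <= 96 * b ^+ 2 * s -> 0 <= B <= T ^+ 2 / 12 ->
  0 <= C <= T ^+ 2 / 12 * q -> 0 <= p <= 1 ->
  N * ((k + 1) * (A + 1) + k * (432 * (34 / 3 * B + 6 * (k + 1) ^+ 2) + 2)) +
    p * (k * (432 * (136 / 3 * C))) <=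
  1728 * (137 * 100) * b ^+ 3 * (s * (1 + r) * l + r ^+ 3 * q).
Proof.
move=> /andP[N0 Nl] k0 kT TE b1 r1 /andP[l1 lq] s0 /andP[A0 Ab] /andP[B0 BT]
  /andP[C0 CT] /andP[p0 p1].
have b0 : 0 <= b := le_trans ler01 b1.
have r0 : 0 <= r := le_trans ler01 r1.
have l0 : 0 <= l := le_trans ler01 l1.
have T1 : 1 <= T.
  rewrite TE -mulrA; have : 1 <= b * r by rewrite -[leLHS]mulr1 ler_pM.
  lra.
have T0 : 0 <= T := le_trans ler01 T1.
have Nk : N * (k + 1) <= 4 * l * T by apply: ler_pM => //; lra.
have Nk0 : 0 <= N * (k + 1) by rewrite mulr_ge0//; lra.
have kT2 : (k + 1) ^+ 2 <= T ^+ 2 by rewrite ler_pXn2r// nnegrE; lra.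
have T20 : 0 <= T ^+ 2 by exact: sqr_ge0.
have hA : N * (k + 1) * A <= 4 * l * T * (96 * b ^+ 2 * s) by apply: ler_pM.
have hB : N * (k + 1) * B <= 4 * l * T * (T ^+ 2 / 12) by apply: ler_pM.
have hk : N * (k + 1) * (k + 1) ^+ 2 <= 4 * l * T * T ^+ 2.
  by apply: ler_pM => //; exact: sqr_ge0.
have hC : k * C <= T * (T ^+ 2 / 12 * q) by apply: ler_pM => //; lra.
have hC' : p * (k * C) <= k * C by rewrite ler_piMl// mulr_ge0.
have NB0 : 0 <= N * B by exact: mulr_ge0.
have Nk20 : 0 <= N * (k + 1) ^+ 2 by rewrite mulr_ge0 ?sqr_ge0.
have T3 : l * T * T ^+ 2 <= q * T * T ^+ 2.
  by rewrite ler_wpM2r// ler_wpM2r.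
have lT : l * T <= q * T * T ^+ 2.
  rewrite -[leLHS]mulr1; apply: ler_pM => //; [exact: mulr_ge0| |].
    by rewrite ler_wpM2r.
  by rewrite -(@expr1n _ 2) ler_pXn2r// nnegrE.
apply: (@le_trans _ _ (4 * l * T * (96 * b ^+ 2 * s) + 137 * 100 * (q * T * T ^+ 2))).
  lra.
have -> : 137 * 100 * (q * T * T ^+ 2) = 1728 * (137 * 100) * b ^+ 3 * (r ^+ 3 * q).
  by rewrite TE; ring.
rewrite [leRHS]mulrDr lerD2r.
have -> : 4 * l * T * (96 * b ^+ 2 * s) = b ^+ 3 * (s * r * l) * (4 * 12 * 96).
  by rewrite TE; ring.
have b3 : 0 <= b ^+ 3 by exact: exprn_ge0.
have srl : 0 <= s * r * l by rewrite mulr_ge0 ?mulr_ge0.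
have sl : 0 <= s * l by exact: mulr_ge0.
have p1' : 0 <= b ^+ 3 * (s * r * l) by exact: mulr_ge0.
have p2' : 0 <= b ^+ 3 * (s * l) by exact: mulr_ge0.
lra.
Qed.

End Complexity.

Theorem theorem5p1 (R : realType) :
  exists C : R -> R,
  forall (d : nat) (dot : {dot 'rV[R]_d for idfun})
    (F : 'rV[R]_d -> 'rV[R]_d) (L mu sigma eta0 : R) (u0 ustar : 'rV[R]_d)
    (dZ : measure_display) (Z : measurableType dZ) (Pz : probability Z R)
    (Fhat : 'rV[R]_d -> Z -> 'rV[R]_d)
    (dO : measure_display) (Omega : measurableType dO) (P : probability Omega R)
    (z : nat -> nat -> nat -> {RV P >-> Z})
    (c : nat -> nat -> {RV P >-> bool}),
  0 < L -> 0 < mu -> 0 <= sigma ->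
  monotone_operator dot F ->
  lipschitz_operator dot L F ->
  F ustar = 0 ->
  sharp_operator dot mu F ustar ->
  stochastic_oracle dot Pz F Fhat sigma L ->
  algorithm_randomness Pz z c ->
  0 < eta0 <= (3 * Num.sqrt 3 * L)^-1 ->
  let D := dnorm dot (u0 - ustar) in
  let uN eps w :=
    restarted_output dot Fhat sigma L mu eta0 u0 ustar eps
      (fun n k i => z n k i w) (fun n k => c n k w) in
  let queries eps w :=
    restarted_queries dot Fhat sigma L mu eta0 u0 ustar eps
      (fun n k i => z n k i w) (fun n k => c n k w) in
  (forall eps : R, 0 < eps ->
     ('E_P[fun w => (dnorm dot (uN eps w - ustar) ^+ 2)%R] <= (eps ^+ 2)%:E)%E /\
     ('E_P[fun w => (dnorm dot (F (uN eps w)) ^+ 2)%R]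
        <= (L ^+ 2 * eps ^+ 2)%:E)%E) /\
  (u0 != ustar ->
   \forall eps \near (0 : R)^'+,
     (restart_calls dot u0 ustar eps * restart_inner L mu eta0)%:R
       <= C (L * eta0) * (L / mu * ln (D / eps)) /\
     ('E_P[fun w => (queries eps w)%:R]
        <= (C (L * eta0) *
            ((sigma ^+ 2 * (mu + L) * ln (D / eps) + L ^+ 3 * D ^+ 2)
               / (mu ^+ 3 * eps ^+ 2)))%:E)%E).
Proof.
exists (fun a => 1728 * (137 * 100) * a^-1 ^+ 3).
move=> d dot F L mu sigma eta0 u0 ustar dZ Z Pz Fhat dO Omega P z c.
move=> L0 mu0 sigma0 mono lip Fstar sharp oracle rnd eta0L D uN queries.
have small := coefM_small L0 eta0L; have /andP[eta0_gt0 _] := eta0L.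
split => [eps eps0|u0ustar].
  have [_ _ distance] := restart_final u0 oracle rnd L0 mu0 eps0 eta0_gt0 small mono lip
    Fstar sharp.
  have mres : measurable_vec (uN eps).
    exact: (known_vec (@known_restarted R d dot dO Omega P dZ Z Pz F Fhat sigma L mu
      eta0 eps u0 z c oracle (restart_calls dot u0 ustar eps))).
  have mFres : measurable_vec (fun w => F (uN eps w)).
    exact: (measurable_operator oracle mres).
  have E : ('E_P[fun w => (dnorm dot (uN eps w - ustar) ^+ 2)%R] <= (eps ^+ 2)%:E)%E.
    rewrite unlock; apply: le_trans distance.
    by under eq_integral do rewrite dnormE.
  split => //.
  have := mean_leZ (sqr_ge0 L) (restart_final u0 oracle rnd L0 mu0 eps0 eta0_gt0 small
    mono lip Fstar sharp) => residual.
  have : mean_le P (fun w => dot (F (uN eps w)) (F (uN eps w))) (L ^+ 2 * eps ^+ 2).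
    apply: mean_le_le residual.
      exact: measurable_dot.
    move=> w; rewrite dot_ge0 andTb.
    by have := lipschitz_norm2 L0 lip (uN eps w) ustar; rewrite Fstar subr0.
  case=> _ _; rewrite unlock; apply: le_trans.
  by under eq_integral do rewrite dnormE.
have DE : D ^+ 2 = dot (u0 - ustar) (u0 - ustar) by exact: dnormE.
have D0 : 0 < D by rewrite sqrtr_gt0 dot_gt0// subr_eq0.
(* sharpness and the Lipschitz condition at [u0], which differs from [ustar] *)
have muL : mu <= L.
  have := sharp u0; rewrite Fstar subr0 => /le_trans/(_ (dot_cauchy_schwarz _ _ _)).
  have := lip u0 ustar; rewrite Fstar subr0 -/D => FL.
  move=> /le_trans/(_ (ler_wpM2r (ltW D0) FL)).
  by rewrite -mulrA -expr2 ler_pM2r// exprn_gt0.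
pose b := (L * eta0)^-1; pose r := L / mu.
have r1 : 1 <= r by rewrite ler_pdivlMr ?mul1r.
near=> eps.
have eps0 : 0 < eps by near: eps; exact: nbhs_right_gt.
(* so that the logarithm is at least 1 and absorbs the roundings *)
have epsD : eps <= D / expR 1.
  by near: eps; apply: nbhs_right_ltW; rewrite divr_gt0// expR_gt0.
have eD : expR 1 <= D / eps.
  by rewrite ler_pdivlMr// mulrC -ler_pdivlMr ?expR_gt0//.
have x0 : 0 < D / eps by rewrite divr_gt0.
have l1 : 1 <= ln (D / eps) by rewrite -[leLHS]expRK ler_ln ?posrE ?expR_gt0//.
have N4 := restart_calls_le eps0 D0 l1.
have K12 := restart_inner_le L0 mu0 eta0_gt0 small muL.
have e12 := restart_accuracy_inv L0 mu0 eps0 eta0_gt0 small.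
have e0 := restart_accuracy_gt0 L0 mu0 eps0 eta0_gt0 small.
rewrite -/D -/b -/r in N4 K12 e12.
have b1 : 1 <= b.
  rewrite -invr1 lef_pV2 ?posrE ?mulr_gt0//.
  rewrite -(@expr_le1 _ 2) ?mulr_ge0 ?ltW// exprMn.
  by have : 9 * L ^+ 2 * eta0 ^+ 2 <= 3^-1 := small; lra.
have bE : (L * eta0)^-1 = b by [].
rewrite /= bE.
have N0 : (0 : R) <= (restart_calls dot u0 ustar eps)%:R <= 4 * ln (D / eps).
  by rewrite ler0n.
split; first by rewrite natrM; exact: iteration_count.
have [_ _ cost] := restart_queries u0 oracle rnd L0 mu0 eps0 eta0_gt0 small mono lip
  Fstar sharp (restart_calls dot u0 ustar eps).
rewrite unlock; apply: le_trans cost _; rewrite lee_fin.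
have mu2 : 0 < mu ^+ 2 * eps ^+ 2 by rewrite mulr_gt0 ?exprn_gt0.
have -> : 1728 * (137 * 100) * b ^+ 3 * ((sigma ^+ 2 * (mu + L) * ln (D / eps) +
      L ^+ 3 * D ^+ 2) / (mu ^+ 3 * eps ^+ 2)) =
    1728 * (137 * 100) * b ^+ 3 * (sigma ^+ 2 / (mu ^+ 2 * eps ^+ 2) * (1 + r) *
      ln (D / eps) + r ^+ 3 * (D / eps) ^+ 2).
  congr (_ * _); rewrite /r; move: (ln _) => l.
  by field; lra.
have e2 : 0 < restart_accuracy L mu eta0 eps ^+ 2 by rewrite exprn_gt0.
have s0 : 0 <= sigma ^+ 2 by exact: sqr_ge0.
have lq : ln (D / eps) <= (D / eps) ^+ 2.
  apply: le_trans (ltW (ln_sublinear x0)) _.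
  have x1 : 1 <= D / eps.
    by apply: le_trans eD; apply: le_trans (expR_ge1Dx 1); lra.
  by rewrite -[leLHS]expr1 ler_weXn2l.
have scale (x y : R) : 0 <= x -> x / (mu ^+ 2 * eps ^+ 2) = y ->
    0 <= x / restart_accuracy L mu eta0 eps ^+ 2 <= 12 * b ^+ 2 * y.
  move=> x0' <-; rewrite divr_ge0 ?(ltW e2)//=.
  have := ler_wpM2l x0' e12; congr (_ <= _).
  by rewrite mulrCA mulrA; congr (_ / _); rewrite mulrC.
apply: (@query_count _ _ _ _ _ _ b r (ln (D / eps)) ((D / eps) ^+ 2)
  (sigma ^+ 2 / (mu ^+ 2 * eps ^+ 2)) (12 * b * r)) => //.
- by rewrite l1 lq.
- by rewrite divr_ge0// ltW.
- have := @scale (8 * sigma ^+ 2) (8 * (sigma ^+ 2 / (mu ^+ 2 * eps ^+ 2))).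
  rewrite mulr_ge0// mulrA => /(_ isT erefl) /andP[-> h] /=.
  by apply: le_trans h _; lra.
- have := @scale (L ^+ 2 * eps ^+ 2) (r ^+ 2).
  rewrite mulr_ge0 ?sqr_ge0// => /(_ isT) h.
  have {}h := h _; rewrite (_ : (12 * b * r) ^+ 2 / 12 = 12 * b ^+ 2 * r ^+ 2).
    by apply: h; rewrite /r; field; lra.
  by field.
- have := @scale (L ^+ 2 * dot (u0 - ustar) (u0 - ustar)) (r ^+ 2 * (D / eps) ^+ 2).
  rewrite mulr_ge0 ?dot_ge0 ?sqr_ge0// => /(_ isT) h.
  rewrite (_ : (12 * b * r) ^+ 2 / 12 * (D / eps) ^+ 2 =
    12 * b ^+ 2 * (r ^+ 2 * (D / eps) ^+ 2)).
    by apply: h; rewrite -DE /r; field; lra.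
  by field; lra.
- rewrite subr_ge0 gerBl exprn_ge0 ?invr_ge0// andbT.
  by rewrite exprn_ile1 ?invr_ge0// invf_le1//; lra.
Unshelve. all: by end_near. Qed.
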